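(* Let $\mu^B\colon(\mathbb B,v_0)\to(\mathbb A,u_0)$ be a pointed covering and let $\mu^C\colon(\mathbb C,w_0)\to(\mathbb A,u_0)$ be a morphism of pointed graphs of groups, all graphs of groups being connected. There exists a pointed morphism (a lift) $\sigma\colon(\mathbb C,w_0)\to(\mathbb B,v_0)$ such that $\mu^B\circ\sigma\sim\mu^C$ if and only if $\mu^C_*(\pi_1(\mathbb C,w_0))\le\mu^B_*(\pi_1(\mathbb B,v_0))$. Moreover, this lift is unique up to $\sim$-equivalence. In this situation, $(\mathbb C,w_0)$, with projection morphisms $1_{\mathbb C}$ (to $(\mathbb C,w_0)$) and $\sigma$ (to $(\mathbb B,v_0)$), is the pullback of $\mu^B$ and $\mu^C$ in $\mathrm{GrGp}^*$.
   Context: **Conventions.** For group elements, $x^g=g^{-1}xg$ and $\gamma_g(x)=x^g$. A graph $\mathsf A$ has a vertex set $V(\mathsf A)$, an edge set $E(\mathsf A)$, maps $o,t\colon E(\mathsf A)\to V(\mathsf A)$ and a fixed-point-free involution $e\mapsto e^{-1}$ on edges with $t(e^{-1})=o(e)$; graph morphisms preserve this structure. $\mathrm{Star}(v)$ is the set of edges with origin $v$. **Graphs of groups.** A graph of groups $\mathbb A$ consists of a graph $\mathsf A$, vertex groups $A_u$, edge groups $A_e=A_{e^{-1}}$, and monomorphisms $\alpha_e\colon A_e\to A_{o(e)}$, $\omega_e\colon A_e\to A_{t(e)}$ with $\omega_e=\alpha_{e^{-1}}$. It is connected if $\mathsf A$ is. A pointed graph of groups $(\mathbb A,u_0)$ has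 a distinguished vertex $u_0$. **Paths.** An $\mathbb A$-path of length $k$ is a sequence $p=(a_0,e_1,a_1,\dots,e_k,a_k)$ where $(e_1,\dots,e_k)$ is a path in $\mathsf A$, $a_{i-1}\in A_{o(e_i)}$, $a_k\in A_{t(e_k)}$ (for $k=0$: $p=(a)$ with $a$ in a vertex group). Paths are concatenated by multiplying the adjacent group elements; a circuit is a path with equal ends. The congruence $=_{\mathbb A}$ is generated by $(1,e,\omega_e(x),e^{-1},1)=_{\mathbb A}(\alpha_e(x))$, $x\in A_e$. $\pi_1(\mathbb A,u)$ is the group of $=_{\mathbb A}$-classes of circuits at $u$. **Morphisms.** A morphism $\mu\colon\mathbb B\to\mathbb A$ consists of a graph morphism $\mathsf B\to\mathsf A$ (also written $\mu$), monomorphisms $\mu_v\colon B_v\to A_{\mu(v)}$ and $\mu_f\colon B_f\to A_{\mu(f)}$, and, for each edge $f$ of $\mathsf B$, twisting elements $f_\alpha\in A_{\mu(o(f))}$, $f_\omega\in A_{\mu(t(f))}$ with $(f^{-1})_\alpha=f_\omega$ and $(f^{-1})_\omega=f_\alpha$, such that with $e=\mu(f)$, $v=o(f)$, $v'=t(f)$: $\alpha_e\circ\mu_f=\gamma_{f_\alpha}\circ\mu_v\circ\alpha_f$ and $\omega_e\circ\mu_f=\gamma_{f_\omega}\circ\mu_{v'}\circ\omega_f$. It is pointed if it maps basepoint to basepoint. It acts on paths by $\mu(b_0,f_1,b_1,\dots,f_k,b_k)=(\mu(b_0)(f_1)_\alpha,\mu(f_1),(f_1)_\omega^{-1}\mu(b_1)(f_2)_\alpha,\dots,\mu(f_k),(f_k)_\omega^{-1}\mu(b_k))$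 and induces $\mu_*\colon\pi_1(\mathbb B,v)\to\pi_1(\mathbb A,\mu(v))$. Morphisms $\mu\colon\mathbb C\to\mathbb B$, $\nu\colon\mathbb B\to\mathbb A$ compose in the obvious way, the $\alpha$-twisting element of an edge $g$ under $\nu\circ\mu$ being $\nu(g_\alpha)\,\mu(g)_\alpha$. **Immersions and coverings.** $\mu$ is an immersion if (i) for edges $f,f'$ of $\mathsf B$ with common origin $v$ and common image $e$, $f=f'$ if and only if $\mu_v(B_v)f_\alpha\alpha_e(A_e)=\mu_v(B_v)f'_\alpha\alpha_e(A_e)$; and (ii) for every edge $f$ with $v=o(f)$, $e=\mu(f)$: $\alpha_e(\mu_f(B_f))=\mu_v(B_v)^{f_\alpha}\cap\alpha_e(A_e)$. It is a covering if it is an immersion and for each vertex $v$ of $\mathsf B$ the map $\mathrm{Star}(v)\to\bigsqcup_{e\in\mathrm{Star}(\mu(v))}\mu(B_v)\backslash A_{\mu(v)}/\alpha_e(A_e)$, $f\mapsto\mu(B_v)f_\alpha\alpha_{\mu(f)}(A_{\mu(f)})$, is bijective. A pointed covering is a pointed morphism that is a covering. **Equivalence.** Two pointed morphisms $\mu^1,\mu^2\colon(\mathbb B,v_0)\to(\mathbb A,u_0)$ of connected pointed graphs of groups are $\sim$-equivalent if they agree on the underlying graph and there are elements $a_v\in A_{\mu^1(v)}$ ($v\in V(\mathsf B)$) and $a_f\in A_{\mu^1(f)}$ ($f\in E(\mathsf B)$) with $a_{v_0}=1$, $a_{f^{-1}}=a_f$, $\mu^2_v=\gamma_{a_v}\circ\mu^1_v$,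 and $a_v=f^1_\alpha\,\alpha_{\mu^1(f)}(a_f)\,(f^2_\alpha)^{-1}$ whenever $o(f)=v$, where $f^i_\alpha$ is the twisting element for $\mu^i$. The category $\mathrm{GrGp}^*$ has as objects the connected pointed graphs of groups and as arrows the $\sim$-classes of pointed morphisms. **Pullback.** In a category, the pullback of $\mu^B\colon B\to A$ and $\mu^C\colon C\to A$ is an object $P$ with arrows $\rho^B\colon P\to B$, $\rho^C\colon P\to C$ such that $\mu^B\rho^B=\mu^C\rho^C$ and, for all $\sigma^B\colon P'\to B$, $\sigma^C\colon P'\to C$ with $\mu^B\sigma^B=\mu^C\sigma^C$, there is a unique $\sigma\colon P'\to P$ with $\rho^B\sigma=\sigma^B$, $\rho^C\sigma=\sigma^C$. *)

(* Defs.v *)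
From HB Require Import structures.
From mathcomp Require Import all_boot all_classical.

Set Implicit Arguments.
Unset Strict Implicit.
Unset Printing Implicit Defensive.

Local Open Scope classical_set_scope.
Local Open Scope group_scope.
Local Open Scope quotient_scope.

Record monomorphism (G H : groupType) := Monomorphism {
  mono_hom :> UMagmaMorphism.type G H;
  mono_inj : injective mono_hom
}.

Section MonoComp.
Variables (G H K : groupType) (g : monomorphism H K) (f : monomorphism G H).

Definition mono_comp_fun (x : G) : K := g (f x).

Fact mono_comp_is_hom : monoid_morphism mono_comp_fun.
Proof. by split=> [|x y]; rewrite /mono_comp_fun ?gmulf1 ?gmulfM. Qed.

HB.instance Definition _ :=
  isUMagmaMorphism.Build G K mono_comp_fun mono_comp_is_hom.

Fact mono_comp_inj : injective mono_comp_fun.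
Proof. by move=> x y /mono_inj /mono_inj. Qed.

Definition mono_comp : monomorphism G K :=
  @Monomorphism G K mono_comp_fun mono_comp_inj.
End MonoComp.

Section MonoId.
Variable G : groupType.

Definition mono_id_fun (x : G) : G := x.

Fact mono_id_is_hom : monoid_morphism mono_id_fun. Proof. by []. Qed.

HB.instance Definition _ :=
  isUMagmaMorphism.Build G G mono_id_fun mono_id_is_hom.

Definition mono_id : monomorphism G G :=
  @Monomorphism G G mono_id_fun (fun x y => id).
End MonoId.

(** [same_elt x y]: the groups [G] and [H] are equal and, under that equality,
    so are the elements [x] and [y]. *)
Definition same_elt (G H : groupType) (x : G) (y : H) : Prop :=
  existT (fun K : groupType => K : Type) G x = existT _ H y.

(** The edge set is split according to the endpoints: [edge u v] is the set of
    edges [e] with [o(e) = u] and [t(e) = v].  An edge with [u <> v] is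
    different from its inverse, as its origin is; hence only loops occur in
    [einv_neq]. *)
Record graph := Graph {
  vertex :> Type;
  edge : vertex -> vertex -> Type;
  einv : forall u v, edge u v -> edge v u;
  einvK : forall u v (e : edge u v), einv (einv e) = e;
  einv_neq : forall u (e : edge u u), einv e <> e
}.
Arguments edge {g} u v.
Arguments einv {g u v} e.

Definition star (X : graph) (v : X) := {w : X & edge v w}.

Inductive walk (X : graph) : X -> X -> Prop :=
| walk_nil u : walk u u
| walk_cons u w v : edge u w -> walk w v -> walk u v.

Definition connected (X : graph) := forall u v : X, walk u v.

Record graph_hom (X Y : graph) := GraphHom {
  hvert :> X -> Y;
  hedge : forall u v, edge u v -> edge (hvert u) (hvert v);
  hedge_inv : forall u v (e : edge u v), hedge (einv e) = einv (hedge e)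
}.
Arguments hedge {X Y} g {u v} e.

Definition graph_id (X : graph) : graph_hom X X :=
  @GraphHom X X id (fun _ _ => id) (fun _ _ _ => erefl).

Fact graph_comp_inv (X Y Z : graph) (psi : graph_hom Y Z) (phi : graph_hom X Y)
    (u v : X) (e : edge u v) :
  hedge psi (hedge phi (einv e)) = einv (hedge psi (hedge phi e)).
Proof. by rewrite !hedge_inv. Qed.

Definition graph_comp (X Y Z : graph) (psi : graph_hom Y Z)
    (phi : graph_hom X Y) : graph_hom X Z :=
  @GraphHom X Z (fun v => psi (phi v))
    (fun u v e => hedge psi (hedge phi e)) (graph_comp_inv psi phi).

Definition star_map (X Y : graph) (phi : graph_hom X Y) (v : X) (f : star v) :
    star (phi v) :=
  existT _ (phi (projT1 f)) (hedge phi (projT2 f)).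

(** [egrp_inv] says that [A_{e^-1} = A_e] and that [alpha_{e^-1} = omega_e]. *)
Record gog := Gog {
  gog_graph :> graph;
  vgrp : gog_graph -> groupType;
  egrp : forall u v : gog_graph, edge u v -> groupType;
  alpha : forall (u v : gog_graph) (e : edge u v),
    monomorphism (egrp e) (vgrp u);
  omega : forall (u v : gog_graph) (e : edge u v),
    monomorphism (egrp e) (vgrp v);
  egrp_inv : forall (u v : gog_graph) (e : edge u v),
    existT (fun K : groupType => monomorphism K (vgrp v))
      (egrp (einv e)) (alpha (einv e)) =
    existT _ (egrp e) (omega e)
}.
Arguments vgrp : clear implicits.
Arguments vgrp {g} u.
Arguments egrp {g u v} e.
Arguments alpha {g u v} e.
Arguments omega {g u v} e.

Lemma existT_inj (T : Type) (P : T -> Type) (t : T) (x y : P t) :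
  existT P t x = existT P t y -> x = y.
Proof.
move=> e; have := projT2_eq e.
by rewrite (Prop_irrelevance (projT1_eq e) erefl).
Qed.

Lemma same_elt_inv (A : gog) (u v : A) (e : edge u v)
    (x : egrp (einv e)) (y : egrp e) :
  same_elt x y <-> alpha (einv e) x = omega e y.
Proof.
move: (egrp_inv e) x y.
move: (alpha (einv e)) (omega e); move: (egrp (einv e)) (egrp e) => G H a o ao.
have /= GH := projT1_eq ao; subst H; rewrite (existT_inj ao) => x y.
split=> xy; first by congr (o _); exact: existT_inj xy.
by rewrite /same_elt (mono_inj xy).
Qed.

(** [pcons a e p] is the path [(a, e, p)], that is [p] with [a, e] put in
    front. *)
Inductive gpath (A : gog) : A -> A -> Type :=
| pnil (u : A) : vgrp u -> gpath u u
| pcons (u w v : A) : vgrp u -> edge u w -> gpath w v -> gpath u v.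
Arguments pnil {A u} a.
Arguments pcons {A u w v} a e p.

HB.instance Definition _ (A : gog) (u v : A) := gen_eqMixin (gpath u v).
HB.instance Definition _ (A : gog) (u v : A) := gen_choiceMixin (gpath u v).

(** Left multiplication of the first group element of a path. *)
Definition pact (A : gog) (u v : A) (p : gpath u v) : vgrp u -> gpath u v :=
  match p with
  | pnil _ b => fun a => pnil (a * b)
  | pcons _ _ _ b e q => fun a => pcons (a * b) e q
  end.

Fixpoint pcat (A : gog) (u v w : A) (p : gpath u v) :
    gpath v w -> gpath u w :=
  match p with
  | pnil _ a => fun q => pact q a
  | pcons _ _ _ a e p' => fun q => pcons a e (pcat p' q)
  end.

Inductive peq (A : gog) : forall u v : A, gpath u v -> gpath u v -> Prop :=
| peq_edge u v (e : edge u v) (x : egrp e) :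
    peq (pcons 1 e (pcons (omega e x) (einv e) (pnil 1))) (pnil (alpha e x))
| peq_refl u v (p : gpath u v) : peq p p
| peq_sym u v (p q : gpath u v) : peq p q -> peq q p
| peq_trans u v (p q r : gpath u v) : peq p q -> peq q r -> peq p r
| peq_cat u v w (p p' : gpath u v) (q q' : gpath v w) :
    peq p p' -> peq q q' -> peq (pcat p q) (pcat p' q').

Fixpoint pinv (A : gog) (u v : A) (p : gpath u v) : gpath v u :=
  match p with
  | pnil _ a => pnil a^-1
  | pcons _ _ _ a e p' => pcat (pinv p') (pcons 1 (einv e) (pnil a^-1))
  end.

Section PathTheory.
Variable A : gog.
Implicit Types u v w z : A.

Lemma pact1 u v (p : gpath u v) : pact p 1 = p.
Proof. by case: p => *; rewrite /= mul1g. Qed.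

Lemma pactM u v (p : gpath u v) a b : pact p (a * b) = pact (pact p b) a.
Proof. by case: p a b => *; rewrite /= mulgA. Qed.

Lemma pcat_act u v w (p : gpath u v) (q : gpath v w) a :
  pcat (pact p a) q = pact (pcat p q) a.
Proof. by case: p a q => * //=; rewrite pactM. Qed.

Lemma pcatA u v w z (p : gpath u v) (q : gpath v w) (r : gpath w z) :
  pcat p (pcat q r) = pcat (pcat p q) r.
Proof.
elim: p q => [v' a|u' w' v' a e p IHp] q /=; first by rewrite pcat_act.
by rewrite IHp.
Qed.

Lemma pcat1p u v (p : gpath u v) : pcat (pnil 1) p = p.
Proof. exact: pact1. Qed.

Lemma pcatp1 u v (p : gpath u v) : pcat p (pnil 1) = p.
Proof. by elim: p => [*|*] /=; [rewrite mulg1 | congr pcons]. Qed.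

Lemma peq_edge1 u v (e : edge u v) :
  peq (pcons 1 e (pcons 1 (einv e) (pnil 1))) (pnil 1).
Proof. by have := peq_edge (1 : egrp e); rewrite !gmulf1. Qed.

Lemma peq_edge1V u v (e : edge u v) :
  peq (pcons 1 (einv e) (pcons 1 e (pnil 1))) (pnil 1).
Proof. by have := peq_edge1 (einv e); rewrite einvK. Qed.

Lemma pcatpV u v (p : gpath u v) : peq (pcat p (pinv p)) (pnil 1).
Proof.
elim: p => [u' a|u' w v' a e p IHp] /=; first by rewrite mulgV; exact: peq_refl.
have -> : pcons a e (pcat p (pcat (pinv p) (pcons 1 (einv e) (pnil a^-1)))) =
    pcat (pcons a e (pnil 1))
      (pcat (pcat p (pinv p)) (pcons 1 (einv e) (pnil a^-1))).
  by rewrite -pcatA /= pact1.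
apply: peq_trans
  (peq_cat (peq_refl _) (peq_cat IHp (peq_refl _))) _.
have -> : pcat (pcons a e (pnil 1))
      (pcat (pnil 1) (pcons 1 (einv e) (pnil a^-1))) =
    pcat (pcat (pnil a) (pcons 1 e (pcons 1 (einv e) (pnil 1)))) (pnil a^-1).
  by rewrite /= !mul1g mulg1.
apply: peq_trans (peq_cat (peq_cat (peq_refl _) (peq_edge1 e)) (peq_refl _)) _.
by rewrite /= mulg1 mulgV; exact: peq_refl.
Qed.

Lemma pcatVp u v (p : gpath u v) : peq (pcat (pinv p) p) (pnil 1).
Proof.
elim: p => [u' a|u' w v' a e p IHp] /=; first by rewrite mulVg; exact: peq_refl.
have -> : pcat (pcat (pinv p) (pcons 1 (einv e) (pnil a^-1))) (pcons a e p) =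
    pcat (pcat (pinv p) (pcons 1 (einv e) (pcons 1 e (pnil 1)))) p.
  by rewrite -!pcatA /= mulVg pact1.
apply: peq_trans
  (peq_cat (peq_cat (peq_refl _) (peq_edge1V e)) (peq_refl _)) _.
by rewrite pcatp1.
Qed.

Lemma peq_inv u v (p q : gpath u v) : peq p q -> peq (pinv p) (pinv q).
Proof.
move=> pq; rewrite -[pinv p]pcatp1 -[pinv q]pcat1p.
apply: peq_trans (peq_cat (peq_refl _) (peq_sym (pcatpV q))) _.
rewrite pcatA; apply: peq_cat (peq_refl _).
by apply: peq_trans (peq_cat (peq_refl _) (peq_sym pq)) _; exact: pcatVp.
Qed.

Definition peqb u v : rel (gpath u v) := fun p q => `[< peq p q >].

Fact peqb_refl u v : reflexive (@peqb u v).
Proof. by move=> p; apply/asboolP; exact: peq_refl. Qed.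
Fact peqb_sym u v : symmetric (@peqb u v).
Proof. by move=> p q; apply: asbool_equiv_eq; split; exact: peq_sym. Qed.
Fact peqb_trans u v : transitive (@peqb u v).
Proof.
by move=> q p r /asboolP pq /asboolP qr; apply/asboolP; exact: peq_trans qr.
Qed.

Canonical peq_equiv u v :=
  EquivRel (@peqb u v) (@peqb_refl u v) (@peqb_sym u v) (@peqb_trans u v).

End PathTheory.

Definition pi1 (A : gog) (u : A) := {eq_quot (peq_equiv u u)}.

HB.instance Definition _ (A : gog) (u : A) := Choice.on (pi1 u).
HB.instance Definition _ (A : gog) (u : A) := EqQuotient.on (pi1 u).

Section Pi1Group.
Variables (A : gog) (u : A).

Lemma pi1P (p q : gpath u u) : \pi_(pi1 u) p = \pi_(pi1 u) q <-> peq p q.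
Proof.
split=> [/eqmodP/asboolP //|pq].
by apply/eqmodP; apply/asboolP.
Qed.

Lemma pi1_repr (p : gpath u u) : peq (repr (\pi_(pi1 u) p)) p.
Proof. by apply/pi1P; rewrite reprK. Qed.

Definition pi1_one : pi1 u := \pi_(pi1 u) (pnil 1).
Definition pi1_mul (x y : pi1 u) : pi1 u := \pi_(pi1 u) (pcat (repr x) (repr y)).
Definition pi1_inv (x : pi1 u) : pi1 u := \pi_(pi1 u) (pinv (repr x)).

Lemma pi1_mulE p q : pi1_mul (\pi_(pi1 u) p) (\pi_(pi1 u) q) = \pi_(pi1 u) (pcat p q).
Proof. by apply/pi1P; apply: peq_cat; exact: pi1_repr. Qed.

Fact pi1_mulA : associative pi1_mul.
Proof.
move=> x y z; apply/pi1P.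
apply: peq_trans (peq_cat (peq_refl _) (pi1_repr _)) _.
rewrite pcatA.
exact: peq_sym (peq_cat (pi1_repr _) (peq_refl _)).
Qed.
Fact pi1_mul1 : left_id pi1_one pi1_mul.
Proof.
move=> x; rewrite -[RHS]reprK; apply/pi1P; rewrite -[X in peq _ X]pcat1p.
exact: peq_cat (pi1_repr _) (peq_refl _).
Qed.
Fact pi1_mulr1 : right_id pi1_one pi1_mul.
Proof.
move=> x; rewrite -[RHS]reprK; apply/pi1P; rewrite -[X in peq _ X]pcatp1.
exact: peq_cat (peq_refl _) (pi1_repr _).
Qed.
Fact pi1_mulV : left_inverse pi1_one pi1_inv pi1_mul.
Proof.
move=> x; apply/pi1P.
apply: peq_trans (peq_cat (pi1_repr _) (peq_refl _)) _; exact: pcatVp.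
Qed.
Fact pi1_mulrV : right_inverse pi1_one pi1_inv pi1_mul.
Proof.
move=> x; apply/pi1P.
apply: peq_trans (peq_cat (peq_refl _) (pi1_repr _)) _; exact: pcatpV.
Qed.

HB.instance Definition _ := isGroup.Build (pi1 u)
  pi1_mulA pi1_mul1 pi1_mulr1 pi1_mulV pi1_mulrV.
End Pi1Group.

(** The part of a morphism that lies over a given graph morphism. *)
Record gog_over (B A : gog) (phi : graph_hom B A) := GogOver {
  over_vert : forall v : B, monomorphism (vgrp v) (vgrp (phi v));
  over_edge : forall (u v : B) (f : edge u v),
    monomorphism (egrp f) (egrp (hedge phi f));
  over_tw_alpha : forall u v : B, edge u v -> vgrp (phi u);
  over_tw_omega : forall u v : B, edge u v -> vgrp (phi v);
  over_tw_inv_alpha : forall (u v : B) (f : edge u v),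
    over_tw_alpha (einv f) = over_tw_omega f;
  over_tw_inv_omega : forall (u v : B) (f : edge u v),
    over_tw_omega (einv f) = over_tw_alpha f;
  over_alpha : forall (u v : B) (f : edge u v) (x : egrp f),
    alpha (hedge phi f) (over_edge f x) =
    over_vert u (alpha f x) ^ over_tw_alpha f;
  over_omega : forall (u v : B) (f : edge u v) (x : egrp f),
    omega (hedge phi f) (over_edge f x) =
    over_vert v (omega f x) ^ over_tw_omega f
}.

Record gog_mor (B A : gog) := GogMor {
  mor_graph :> graph_hom B A;
  mor_over : gog_over mor_graph
}.

Section MorphismData.
Variables (B A : gog) (mu : gog_mor B A).

Definition mvert (v : B) := over_vert (mor_over mu) v.
Definition medge (u v : B) (f : edge u v) := over_edge (mor_over mu) f.
Definition tw_alpha (u v : B) (f : edge u v) := over_tw_alpha (mor_over mu) f.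
Definition tw_omega (u v : B) (f : edge u v) := over_tw_omega (mor_over mu) f.

Lemma tw_inv_alpha u v (f : @edge B u v) : tw_alpha (einv f) = tw_omega f.
Proof. exact: over_tw_inv_alpha. Qed.
Lemma tw_inv_omega u v (f : @edge B u v) : tw_omega (einv f) = tw_alpha f.
Proof. exact: over_tw_inv_omega. Qed.
Lemma medge_alpha u v (f : @edge B u v) x :
  alpha (hedge mu f) (medge f x) = mvert u (alpha f x) ^ tw_alpha f.
Proof. exact: over_alpha. Qed.
Lemma medge_omega u v (f : @edge B u v) x :
  omega (hedge mu f) (medge f x) = mvert v (omega f x) ^ tw_omega f.
Proof. exact: over_omega. Qed.

Fixpoint pmap (u v : B) (p : gpath u v) : gpath (mu u) (mu v) :=
  match p in gpath u v return gpath (mu u) (mu v) with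
  | pnil u b => pnil (mvert u b)
  | pcons u w v b f q =>
      pcons (mvert u b * tw_alpha f) (hedge mu f) (pact (pmap q) (tw_omega f)^-1)
  end.

Lemma pmap_act u v (p : gpath u v) b :
  pmap (pact p b) = pact (pmap p) (mvert u b).
Proof. by case: p b => *; rewrite /= gmulfM ?mulgA. Qed.

Lemma pmap_cat u v w (p : gpath u v) (q : gpath v w) :
  pmap (pcat p q) = pcat (pmap p) (pmap q).
Proof.
elim: p q => [u' b|u' w' v' b f p IHp] q /=; first exact: pmap_act.
by rewrite IHp pcat_act.
Qed.

Lemma pmap_peq u v (p q : gpath u v) : peq p q -> peq (pmap p) (pmap q).
Proof.
elim=> {u v p q} [u v f x|u v p|u v p q _|u v p q r _ + _|
  u v w p p' q q' _ pp' _ qq'].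
- rewrite /= !gmulf1 mul1g mulg1 hedge_inv tw_inv_alpha tw_inv_omega.
  have -> : (tw_omega f)^-1 * (mvert v (omega f x) * tw_omega f) =
      omega (hedge mu f) (medge f x) by rewrite medge_omega conjgE.
  have -> : mvert u (alpha f x) = tw_alpha f * alpha (hedge mu f) (medge f x) *
      (tw_alpha f)^-1.
    by rewrite medge_alpha conjgE !mulgA mulgV mul1g mulgK.
  have -> : pcons (tw_alpha f) (hedge mu f)
        (pcons (omega (hedge mu f) (medge f x)) (einv (hedge mu f))
          (pnil (tw_alpha f)^-1)) =
      pcat (pcat (pnil (tw_alpha f)) (pcons 1 (hedge mu f)
        (pcons (omega (hedge mu f) (medge f x)) (einv (hedge mu f)) (pnil 1))))
        (pnil (tw_alpha f)^-1) by rewrite /= mulg1 mul1g.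
  apply: peq_trans
    (peq_cat (peq_cat (peq_refl _) (peq_edge _)) (peq_refl _)) _.
  exact: peq_refl.
- exact: peq_refl.
- exact: peq_sym.
- exact: peq_trans.
- by rewrite !pmap_cat; exact: peq_cat.
Qed.

Definition pi1_map (v : B) (x : pi1 v) : pi1 (mu v) := \pi_(pi1 (mu v)) (pmap (repr x)).

Lemma pi1_mapE v (p : gpath v v) :
  pi1_map (\pi_(pi1 v) p) = \pi_(pi1 (mu v)) (pmap p).
Proof. by apply/pi1P; apply: pmap_peq; exact: pi1_repr. Qed.

Fact pi1_map_is_hom v : monoid_morphism (@pi1_map v).
Proof.
split=> [|x y]; apply/pi1P.
  by have := pmap_peq (pi1_repr (pnil (1 : vgrp v))); rewrite /= gmulf1.
apply: peq_trans (pmap_peq (pi1_repr _)) _; rewrite pmap_cat.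
exact: peq_sym (peq_cat (pi1_repr _) (pi1_repr _)).
Qed.

HB.instance Definition _ v :=
  isUMagmaMorphism.Build (pi1 v) (pi1 (mu v)) (@pi1_map v) (pi1_map_is_hom v).

End MorphismData.

Section Composition.
Variables (C B A : gog) (nu : gog_mor B A) (mu : gog_mor C B).
Let phi := graph_comp nu mu.

Definition comp_vert (v : C) : monomorphism (vgrp v) (vgrp (phi v)) :=
  mono_comp (mvert nu (mu v)) (mvert mu v).
Definition comp_edge (u v : C) (g : edge u v) :
    monomorphism (egrp g) (egrp (hedge phi g)) :=
  mono_comp (medge nu (hedge mu g)) (medge mu g).
Definition comp_tw_alpha (u v : C) (g : edge u v) : vgrp (phi u) :=
  mvert nu (mu u) (tw_alpha mu g) * tw_alpha nu (hedge mu g).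
Definition comp_tw_omega (u v : C) (g : edge u v) : vgrp (phi v) :=
  mvert nu (mu v) (tw_omega mu g) * tw_omega nu (hedge mu g).

Fact comp_tw_inv_alpha u v (g : @edge C u v) :
  comp_tw_alpha (einv g) = comp_tw_omega g.
Proof. by rewrite /comp_tw_alpha hedge_inv !tw_inv_alpha. Qed.
Fact comp_tw_inv_omega u v (g : @edge C u v) :
  comp_tw_omega (einv g) = comp_tw_alpha g.
Proof. by rewrite /comp_tw_omega hedge_inv !tw_inv_omega. Qed.
Fact comp_alpha u v (g : @edge C u v) x :
  alpha (hedge phi g) (comp_edge g x) = comp_vert u (alpha g x) ^ comp_tw_alpha g.
Proof. by rewrite /= medge_alpha medge_alpha gmulfJ conjgM. Qed.
Fact comp_omega u v (g : @edge C u v) x :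
  omega (hedge phi g) (comp_edge g x) = comp_vert v (omega g x) ^ comp_tw_omega g.
Proof. by rewrite /= medge_omega medge_omega gmulfJ conjgM. Qed.

Definition gog_comp : gog_mor C A := GogMor
  (@GogOver C A phi comp_vert comp_edge comp_tw_alpha comp_tw_omega
    comp_tw_inv_alpha comp_tw_inv_omega comp_alpha comp_omega).
End Composition.

Section Identity.
Variable A : gog.

Definition id_tw_alpha (u v : A) (e : edge u v) : vgrp u := 1.
Definition id_tw_omega (u v : A) (e : edge u v) : vgrp v := 1.
Fact id_alpha (u v : A) (e : edge u v) (x : egrp e) :
  alpha e x = alpha e x ^ 1.
Proof. by rewrite conjg1. Qed.
Fact id_omega (u v : A) (e : edge u v) (x : egrp e) :
  omega e x = omega e x ^ 1.
Proof. by rewrite conjg1. Qed.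

Definition gog_id : gog_mor A A := GogMor
  (@GogOver A A (graph_id A) (fun v => mono_id (vgrp v))
    (fun u v e => mono_id (egrp e)) id_tw_alpha id_tw_omega
    (fun _ _ _ => erefl) (fun _ _ _ => erefl) id_alpha id_omega).
End Identity.

Definition double_coset (G : groupType) (H : set G) (g : G) (K : set G) :
    set G :=
  [set h * g * k | h in H & k in K].

Section Coverings.
Variables (B A : gog) (mu : gog_mor B A).

Definition edge_dcoset (v : B) (f : star v) : set (vgrp (mu v)) :=
  double_coset (range (mvert mu v)) (tw_alpha mu (projT2 f))
    (range (alpha (hedge mu (projT2 f)))).

Definition immersion : Prop :=
  (forall (v : B) (f f' : star v), star_map mu f = star_map mu f' ->
     (f = f' <-> edge_dcoset f = edge_dcoset f')) /\
  (forall (v v' : B) (f : edge v v'),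
     alpha (hedge mu f) @` range (medge mu f) =
     [set x ^ tw_alpha mu f | x in range (mvert mu v)]
       `&` range (alpha (hedge mu f))).

(** The disjoint union of the double coset spaces is the set of the pairs
    consisting of an edge [e] in the star of [mu v] and a double coset for
    that edge. *)
Definition star_dcosets (v : B) : set (star (mu v) * set (vgrp (mu v))) :=
  [set eX | exists g : vgrp (mu v),
     eX.2 = double_coset (range (mvert mu v)) g
              (range (alpha (projT2 eX.1)))].

Definition covering : Prop :=
  immersion /\
  forall v : B, set_bij [set: star v] (@star_dcosets v)
    (fun f : star v => (star_map mu f, edge_dcoset f)).
End Coverings.

Record pgog := PGog {
  pgog_gog :> gog;
  base : pgog_gog;
  pgog_connected : connected pgog_gog
}.
Arguments base : clear implicits.

Record pgog_mor (B A : pgog) := PGogMor {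
  pmor_mor :> gog_mor B A;
  pmor_base : pmor_mor (base B) = base A
}.

Definition pgog_id (A : pgog) : pgog_mor A A :=
  @PGogMor A A (gog_id A) erefl.

Fact pgog_comp_base (C B A : pgog) (nu : pgog_mor B A) (mu : pgog_mor C B) :
  gog_comp nu mu (base C) = base A.
Proof. by rewrite /= !pmor_base. Qed.

Definition pgog_comp (C B A : pgog) (nu : pgog_mor B A) (mu : pgog_mor C B) :
    pgog_mor C A :=
  PGogMor (pgog_comp_base nu mu).

(** [mu_*], as a map to the fundamental group at the basepoint of [A]. *)
Definition pi1_star (B A : pgog) (mu : pgog_mor B A) (x : pi1 (base B)) :
    pi1 (base A) :=
  ecast u (pi1 u) (pmor_base mu) (pi1_map mu x).

(** Two morphisms can be equivalent only if they have the same underlying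
    graph morphism [phi]; [v0] is the basepoint of the source. *)
Definition over_sim (B A : gog) (v0 : B) (phi : graph_hom B A)
    (m1 m2 : gog_over phi) : Prop :=
  exists (a : forall v : B, vgrp (phi v))
    (b : forall (u v : B) (f : edge u v), egrp (hedge phi f)),
    [/\ a v0 = 1,
        forall (u v : B) (f : edge u v), same_elt (b v u (einv f)) (b u v f),
        forall (v : B) (x : vgrp v), over_vert m2 v x = over_vert m1 v x ^ a v
      & forall (u v : B) (f : edge u v),
          a u = over_tw_alpha m1 f * alpha (hedge phi f) (b u v f) *
                (over_tw_alpha m2 f)^-1].

Inductive gog_sim (B A : gog) (v0 : B) : gog_mor B A -> gog_mor B A -> Prop :=
| GogSim (phi : graph_hom B A) (m1 m2 : gog_over phi) :
    over_sim v0 m1 m2 -> gog_sim v0 (GogMor m1) (GogMor m2).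

Definition psim (B A : pgog) (mu1 mu2 : pgog_mor B A) : Prop :=
  gog_sim (base B) mu1 mu2.

Section SimTheory.
Variables (B A : gog) (v0 : B).
Implicit Types phi : graph_hom B A.

Lemma same_elt_refl (G : groupType) (x : G) : same_elt x x.
Proof. by []. Qed.

Lemma same_eltV (G H : groupType) (x : G) (y : H) :
  same_elt x y -> same_elt x^-1 y^-1.
Proof.
move=> e; have /= GH := projT1_eq e; subst H.
by have -> : x = y by exact: existT_inj e.
Qed.

Lemma same_eltM (G H : groupType) (x x' : G) (y y' : H) :
  same_elt x y -> same_elt x' y' -> same_elt (x * x') (y * y').
Proof.
move=> e e'; have /= GH := projT1_eq e; subst H.
have -> : x = y by exact: existT_inj e.
by have -> : x' = y' by exact: existT_inj e'.
Qed.

Lemma same_elt1 (u v : A) (e : edge u v) (e' : edge v u) :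
  e' = einv e -> same_elt (1 : egrp e') (1 : egrp e).
Proof. by move=> ->; apply/same_elt_inv; rewrite !gmulf1. Qed.

Lemma gog_simE phi (m1 m2 : gog_over phi) :
  gog_sim v0 (GogMor m1) (GogMor m2) <-> over_sim v0 m1 m2.
Proof.
split; last exact: GogSim.
pose P (mu : gog_mor B A) := existT (@gog_over B A) (mor_graph mu) (mor_over mu).
suff H mu1 mu2 : gog_sim v0 mu1 mu2 -> P mu1 = existT _ phi m1 ->
    P mu2 = existT _ phi m2 -> over_sim v0 m1 m2 by move/H; apply.
case=> psi n1 n2 n12; rewrite /P /= => e1.
have /= epsi := projT1_eq e1; subst psi => e2.
by rewrite -(existT_inj e1) -(existT_inj e2).
Qed.

Lemma gog_sim_eq (hv : B -> A)
    (he : forall u v : B, edge u v -> edge (hv u) (hv v)) p1 p2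
    (m1 : gog_over (@GraphHom B A hv he p1))
    (m2 : gog_over (@GraphHom B A hv he p2)) :
  (forall (v : B) (x : vgrp v), over_vert m2 v x = over_vert m1 v x) ->
  (forall (u v : B) (f : edge u v),
     over_tw_alpha m2 f = over_tw_alpha m1 f) ->
  gog_sim v0 (GogMor m1) (GogMor m2).
Proof.
have ep : p2 = p1 by exact: Prop_irrelevance.
subst p2 => ev et; apply: GogSim; exists (fun=> 1), (fun _ _ _ => 1); split=> //.
- by move=> u v f; apply: same_elt1; exact: p1.
- by move=> v x; rewrite ev conjg1.
- by move=> u v f; rewrite et gmulf1 mulg1 mulgV.
Qed.

Lemma gog_sim_refl (mu : gog_mor B A) : gog_sim v0 mu mu.
Proof. by case: mu => [[hv he p] m]; exact: gog_sim_eq. Qed.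

Lemma gog_sim_sym (mu1 mu2 : gog_mor B A) : gog_sim v0 mu1 mu2 -> gog_sim v0 mu2 mu1.
Proof.
case=> phi m1 m2 [a [b [a1 bV aP bP]]]; apply: GogSim.
exists (fun v => (a v)^-1), (fun u v f => (b u v f)^-1); split.
- by rewrite a1 invg1.
- by move=> u v f; exact: same_eltV.
- by move=> v x; rewrite aP -conjgM mulgV conjg1.
- by move=> u v f; rewrite (bP u v f) !invgM invgK gmulfV !mulgA.
Qed.

Lemma gog_sim_trans (mu1 mu2 mu3 : gog_mor B A) :
  gog_sim v0 mu1 mu2 -> gog_sim v0 mu2 mu3 -> gog_sim v0 mu1 mu3.
Proof.
case=> phi m1 m2 [a [b [a1 bV aP bP]]].
case: mu3 => psi m3 s.
have epsi : psi = phi.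
  suff H (mu mu' : gog_mor B A) :
      gog_sim v0 mu mu' -> mor_graph mu' = mor_graph mu by exact: H s.
  by case.
subst psi; have /gog_simE [a' [b' [a1' bV' aP' bP']]] := s.
apply: GogSim; exists (fun v => a v * a' v), (fun u v f => b u v f * b' u v f).
split.
- by rewrite a1 a1' mulg1.
- by move=> u v f; exact: same_eltM.
- by move=> v x; rewrite aP' aP conjgM.
- by move=> u v f; rewrite (bP u v f) (bP' u v f) gmulfM !mulgA mulgVK.
Qed.
End SimTheory.

Lemma medge_same (B A : gog) (mu : gog_mor B A) (u v : B)
    (e : edge u v) (e' : edge v u) (x : egrp e') (y : egrp e) :
  e' = einv e -> same_elt x y -> same_elt (medge mu e' x) (medge mu e y).
Proof.
move=> ee'; subst e' => /same_elt_inv xy.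
have H (f : edge (mu v) (mu u)) (x' : egrp f) (y' : egrp (hedge mu e)) :
    f = einv (hedge mu e) -> alpha f x' = omega (hedge mu e) y' ->
    same_elt x' y' by move=> ef; subst f => /same_elt_inv.
by apply: H; [exact: hedge_inv | rewrite medge_alpha medge_omega xy tw_inv_alpha].
Qed.

Lemma gog_sim_compl (C B A : gog) (w0 : C) (nu : gog_mor B A)
    (mu1 mu2 : gog_mor C B) :
  gog_sim w0 mu1 mu2 -> gog_sim w0 (gog_comp nu mu1) (gog_comp nu mu2).
Proof.
case=> phi m1 m2 [a [b [a1 bV aP bP]]]; apply: GogSim.
exists (fun v => mvert nu (phi v) (a v)),
  (fun u v f => medge nu (hedge phi f) (b u v f)); split.
- by rewrite a1 gmulf1.
- by move=> u v f; apply: medge_same; [exact: hedge_inv | exact: bV].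
- by move=> v x; rewrite /= /mono_comp_fun /mvert /= aP gmulfJ.
- move=> u v f; rewrite /= /comp_tw_alpha /tw_alpha /= -!/(mvert _ _).
  rewrite (bP u v f) !gmulfM gmulfV.
  rewrite (medge_alpha nu) conjgE invgM -/(tw_alpha nu (hedge phi f)) !mulgA.
  by rewrite mulgK mulgK.
Qed.

Lemma gog_sim_compr (C B A : gog) (w0 : C) (v0 : B) (nu1 nu2 : gog_mor B A)
    (mu : gog_mor C B) : mu w0 = v0 ->
  gog_sim v0 nu1 nu2 -> gog_sim w0 (gog_comp nu1 mu) (gog_comp nu2 mu).
Proof.
move=> mu0; case=> phi m1 m2 [a [b [a1 bV aP bP]]]; apply: GogSim.
exists (fun w => a (mu w)), (fun u v g => b _ _ (hedge mu g)); split.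
- by move: a1; rewrite -mu0.
- by move=> u v g; have := bV _ _ (hedge mu g); rewrite -(hedge_inv mu g).
- by move=> w x; rewrite /= /mono_comp_fun /mvert /= aP.
- move=> u v g; rewrite /= /comp_tw_alpha /mvert /= aP.
  set c := over_vert m1 _ _; set e := hedge mu g; have := bP _ _ e.
  rewrite /tw_alpha /=; set x := over_tw_alpha m1 e.
  set y := over_tw_alpha m2 e; set z := alpha _ _ => aE.
  have cE : c * x * z * y^-1 = c * a (mu u) by rewrite aE !mulgA.
  by rewrite conjgE !invgM !invgK !mulgA cE mulgK mulgV mul1g.
Qed.

Record category := Category {
  obj :> Type;
  hom : obj -> obj -> Type;
  idc : forall a : obj, hom a a;
  compc : forall a b c : obj, hom b c -> hom a b -> hom a c;
  compcA : forall (a b c d : obj) (h : hom c d) (g : hom b c) (f : hom a b),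
    compc h (compc g f) = compc (compc h g) f;
  compc1 : forall (a b : obj) (f : hom a b), compc (idc b) f = f;
  compc1r : forall (a b : obj) (f : hom a b), compc f (idc a) = f
}.
Arguments hom {_} a b.
Arguments idc {_} a.
Arguments compc {_ a b c} _ _ : rename.

Definition is_pullback (K : category) (A B C : K) (muB : hom B A)
    (muC : hom C A) (P : K) (rhoB : hom P B) (rhoC : hom P C) : Prop :=
  compc muB rhoB = compc muC rhoC /\
  forall (P' : K) (sigmaB : hom P' B) (sigmaC : hom P' C),
    compc muB sigmaB = compc muC sigmaC ->
    exists! sigma : hom P' P,
      compc rhoB sigma = sigmaB /\ compc rhoC sigma = sigmaC.

HB.instance Definition _ (B A : pgog) := gen_eqMixin (pgog_mor B A).
HB.instance Definition _ (B A : pgog) := gen_choiceMixin (pgog_mor B A).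

Section Arrows.
Variables B A : pgog.

Definition psimb : rel (pgog_mor B A) := fun mu nu => `[< psim mu nu >].

Fact psimb_refl : reflexive psimb.
Proof. by move=> mu; apply/asboolP; exact: gog_sim_refl. Qed.
Fact psimb_sym : symmetric psimb.
Proof. by move=> mu nu; apply: asbool_equiv_eq; split; exact: gog_sim_sym. Qed.
Fact psimb_trans : transitive psimb.
Proof.
by move=> nu mu la /asboolP s /asboolP t; apply/asboolP; exact: gog_sim_trans t.
Qed.

Canonical psim_equiv := EquivRel psimb psimb_refl psimb_sym psimb_trans.

Definition arrow := {eq_quot psim_equiv}.

HB.instance Definition _ := Choice.on arrow.
HB.instance Definition _ := EqQuotient.on arrow.

Lemma arrowP (mu nu : pgog_mor B A) : \pi_arrow mu = \pi_arrow nu <-> psim mu nu.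
Proof.
split=> [/eqmodP/asboolP //|mn].
by apply/eqmodP; apply/asboolP.
Qed.

Lemma arrow_repr (mu : pgog_mor B A) : psim (repr (\pi_arrow mu)) mu.
Proof. by apply/arrowP; rewrite reprK. Qed.
End Arrows.

Section ArrowComposition.

Definition arrow_comp (C B A : pgog) (g : arrow B A) (f : arrow C B) :
    arrow C A :=
  \pi_(arrow C A) (pgog_comp (repr g) (repr f)).

Lemma psim_comp (C B A : pgog) (nu1 nu2 : pgog_mor B A)
    (mu1 mu2 : pgog_mor C B) :
  psim nu1 nu2 -> psim mu1 mu2 -> psim (pgog_comp nu1 mu1) (pgog_comp nu2 mu2).
Proof.
move=> n m; apply: (@gog_sim_trans _ _ _ _ (gog_comp nu1 mu2)).
  exact: gog_sim_compl.
by apply: gog_sim_compr n; exact: pmor_base.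
Qed.

Lemma arrow_compE (C B A : pgog) (nu : pgog_mor B A) (mu : pgog_mor C B) :
  arrow_comp (\pi_(arrow B A) nu) (\pi_(arrow C B) mu) =
  \pi_(arrow C A) (pgog_comp nu mu).
Proof. by apply/arrowP; apply: psim_comp; exact: arrow_repr. Qed.

Fact arrow_compA (D C B A : pgog) (h : arrow B A) (g : arrow C B)
    (f : arrow D C) :
  arrow_comp h (arrow_comp g f) = arrow_comp (arrow_comp h g) f.
Proof.
apply/arrowP.
apply: gog_sim_trans (psim_comp (gog_sim_refl _ _) (arrow_repr _)) _.
apply: gog_sim_trans _
  (gog_sim_sym (psim_comp (arrow_repr _) (gog_sim_refl _ _))).
apply: gog_sim_eq => // u v e.
by rewrite /= /comp_tw_alpha /tw_alpha /= /comp_tw_alpha /tw_alpha gmulfM mulgA.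
Qed.

Fact arrow_comp1 (B A : pgog) (f : arrow B A) :
  arrow_comp (\pi_(arrow A A) (pgog_id A)) f = f.
Proof.
rewrite -[RHS]reprK; apply/arrowP.
apply: gog_sim_trans (psim_comp (arrow_repr _) (gog_sim_refl _ _)) _.
case: (repr f) => [[[hv he p] m] p0].
by apply: gog_sim_eq => // u v e; rewrite /= /comp_tw_alpha /= mulg1.
Qed.

Fact arrow_comp1r (B A : pgog) (f : arrow B A) :
  arrow_comp f (\pi_(arrow B B) (pgog_id B)) = f.
Proof.
rewrite -[RHS]reprK; apply/arrowP.
apply: gog_sim_trans (psim_comp (gog_sim_refl _ _) (arrow_repr _)) _.
case: (repr f) => [[[hv he p] m] p0].
by apply: gog_sim_eq => // u v e; rewrite /= /comp_tw_alpha /= gmulf1 mul1g.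
Qed.
End ArrowComposition.

Definition GrGp : category :=
  @Category pgog arrow (fun A => \pi_(arrow A A) (pgog_id A)) arrow_comp
    (fun _ _ _ _ => @arrow_compA _ _ _ _) (@arrow_comp1) (@arrow_comp1r).

Definition arrow_class (B A : pgog) (mu : pgog_mor B A) : @hom GrGp B A :=
  \pi_(arrow B A) mu.

(* Main.v *)
From HB Require Import structures.
From mathcomp Require Import all_boot all_classical.
Require Import Defs.

(** The proof is covering space theory, with the fibre over a vertex [u] of
    [A] taken to be the set of pairs [(v, mu(B_v) g)] of a vertex [v] of [B]
    over [u] and a right coset in [A_u].  If [mu] is a covering, the [A]-paths
    act on the fibres from the right.  A group element [a] sends [mu(B_v) g]
    to [mu(B_v) g a].  An edge [e] acts as follows: exactly one edge [f] of
    [B] at [v] lies over [e] and has [g] in its double coset; write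
    [g = mu(b) f_alpha alpha_e(x)]; if [f] ends at [v'], the image is the coset
    of [f_omega omega_e(x)] at [v'].  Bijectivity of the star maps gives
    existence and uniqueness of [f] ([step_total], [immersion_star]), and the
    second immersion condition makes the result independent of the
    factorization ([immersion_edge], [crosses_func]).  The action respects the
    congruence of paths ([pstep_peq]), and the image of a circuit of [B] at [v0]
    fixes the point [(v0, mu(B_v0))] ([pstep_pmap]).

    Let [nu] be the morphism from [C] to [A].  If
    [nu_*(pi_1(C)) <= mu_*(pi_1(B))], every circuit of [C] at the basepoint
    fixes the base point of the fibre, so that moving this point along
    [nu(p)], for a path [p] from the basepoint to [w], gives a fibre point
    [s_w = (v_w, mu(B_(v_w)) g_w)] that depends on [w] only ([lift_points]).
    The lift sends [w] to [v_w], an edge [h] to the edge of [B] crossed from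
    [s_w] by [nu(h)], and a vertex group element [c] to the element of
    [B_(v_w)] that [mu] maps to [g_w nu(c) g_w^-1]; the twisting elements are
    the factors [b] and [b'] at the two ends of the crossing ([lift_over],
    [lift_of_points]).  The elements [g_w] and [x] witness the equivalence of
    [mu sigma] with [nu].

    Conversely, equivalent morphisms induce the same map on fundamental groups
    ([psim_pi1_star]), hence a lift forces the inclusion of the images.

    For uniqueness, an equivalence of [mu sigma] with [nu] exhibits the
    vertices [sigma w] as fibre points that are carried to each other by the
    edges of [C] ([gog_sim_crosses]).  As [C] is connected, two lifts give the
    same points, thus the same graph morphism, and then the elements of the
    equivalence between their composites with [mu] are themselves images under
    [mu] of an equivalence between the lifts ([immersion_over_sim]).  In the
    category this says that a covering can be cancelled on the left, which is
    what the universal property of the pullback needs ([lift_pullback]). *)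

Set Implicit Arguments.
Unset Strict Implicit.
Unset Printing Implicit Defensive.

Local Open Scope classical_set_scope.
Local Open Scope group_scope.
Local Open Scope quotient_scope.

(** * Edge groups, orientations and induced monomorphisms *)

Lemma egrp_invP (A : gog) (u v : A) (e : edge u v) (e' : edge v u)
    (x : egrp e) : e' = einv e ->
  exists2 x' : egrp e', alpha e' x' = omega e x & omega e' x' = alpha e x.
Proof.
move=> ->.
have [x' x'x] : exists x' : egrp (einv e), same_elt x' x.
  by move: x; have /= <- := projT1_eq (egrp_inv e) => x; exists x.
exists x'; first exact/same_elt_inv.
(* The second equation is the first one for the edge e^-1, read through
   einvK; z is x seen in the edge group of (e^-1)^-1. *)
have H (e2 : edge u v) (z : egrp e2) : e2 = e -> same_elt z x ->
    alpha e2 z = alpha e x.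
  by move=> ee; subst e2 => zx; congr (alpha e _); exact: existT_inj zx.
have [z zx'] : exists z : egrp (einv (einv e)), same_elt z x'.
  by move: {x'x H} x'; have /= <- := projT1_eq (egrp_inv (einv e)) => y; exists y.
rewrite -(H _ z (einvK e) (etrans zx' x'x)).
by move/same_elt_inv: zx' => ->.
Qed.

(** In use, [e'] is the image under a graph morphism of an inverse edge, which
    equals [einv e] only propositionally. *)
Lemma same_elt_einv (A : gog) (u v : A) (e : edge u v) (e' : edge v u)
    (x' : egrp e') (x : egrp e) : e' = einv e ->
  (same_elt x' x <-> alpha e' x' = omega e x).
Proof. by move=> ee; subst e'; exact: same_elt_inv. Qed.

(** Every edge differs from its inverse, so each pair of mutually inverse edges
    has a chosen member. *)
Lemma orientation (X : graph) : exists P : forall u v : X, edge u v -> bool,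
  forall u v (e : edge u v), P v u (einv e) = ~~ P u v e.
Proof.
pose T := {classic {u : X & {v : X & edge u v}}}.
pose tot u v (e : edge u v) : T := existT _ u (existT _ v e).
pose D u v (e : edge u v) : pred T :=
  fun k => `[< k = tot u v e \/ k = tot v u (einv e) >].
exists (fun u v e => choose (D u v e) (tot u v e) == tot u v e) => u v e.
have De : D u v e =1 D v u (einv e).
  by move=> k; apply: asbool_equiv_eq; rewrite einvK; split; case; by [left|right].
have Dl : D u v e (tot u v e) by apply/asboolP; left.
have Dr : D u v e (tot v u (einv e)) by apply/asboolP; right.
have ne : tot u v e != tot v u (einv e).
  apply/eqP => te; have /= uv := projT1_eq te; subst v.
  by have := existT_inj (existT_inj te) => /esym; exact: einv_neq.
rewrite -(eq_choose De) (choose_id Dr Dl).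
have /asboolP[->|->] := chooseP Dl; first by rewrite eqxx (negbTE ne).
by rewrite eqxx eq_sym ne.
Qed.

(** The twisting elements of an edge and its inverse are swapped, so they cannot
    be chosen edge by edge: they are chosen along an orientation and transferred
    to the inverse edges. *)
Lemma edge_choice (X : graph) (T : X -> Type)
    (R : forall u v : X, edge u v -> T u -> T v -> Prop) :
    (forall u v (e : edge u v), exists t t', R u v e t t') ->
    (forall u v (e : edge u v) t t', R u v e t t' -> R v u (einv e) t' t) ->
  exists (ta : forall u v : X, edge u v -> T u)
         (to : forall u v : X, edge u v -> T v),
    [/\ forall u v (e : edge u v), ta v u (einv e) = to u v e,
        forall u v (e : edge u v), to v u (einv e) = ta u v e
      & forall u v (e : edge u v), R u v e (ta u v e) (to u v e)].
Proof.
move=> Rtot Rsym; have [P PV] := orientation X.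
have Rtot' u v (e : edge u v) : {tt : T u * T v | R u v e tt.1 tt.2}.
  by apply: cid; have [t [t' tt']] := Rtot u v e; exists (t, t').
pose pk u v e := sval (Rtot' u v e).
exists (fun u v e => if P u v e then (pk u v e).1 else (pk v u (einv e)).2).
exists (fun u v e => if P u v e then (pk u v e).2 else (pk v u (einv e)).1).
split=> u v e; rewrite ?PV ?einvK; [by case: (P u v e)..|].
case: (P u v e); first exact: (svalP (Rtot' u v e)).
by have := Rsym _ _ _ _ _ (svalP (Rtot' v u (einv e))); rewrite einvK.
Qed.

Lemma monoJ (G H : groupType) (f : monomorphism G H) x y :
  f (x ^ y) = f x ^ f y.
Proof. exact: gmulfJ. Qed.

Lemma monoV (G H : groupType) (f : monomorphism G H) x : f x^-1 = (f x)^-1.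
Proof. exact: gmulfV. Qed.

Section MonoLift.
Variables (G H K : groupType) (m : monomorphism H K) (n : monomorphism G K).
Variables (k : K) (nm : forall x, exists y, m y = n x ^ k).

(** The monomorphism [m^-1 gamma_k n]: the vertex maps and the edge maps of the
    lift all have this form. *)
Definition mono_lift_fun (x : G) : H := sval (cid (nm x)).

Lemma mono_lift_funE x : m (mono_lift_fun x) = n x ^ k.
Proof. exact: (svalP (cid (nm x))). Qed.

Fact mono_lift_is_hom : monoid_morphism mono_lift_fun.
Proof.
split=> [|x y]; apply: (@mono_inj _ _ m).
  by rewrite mono_lift_funE !gmulf1 conj1g.
by rewrite gmulfM !mono_lift_funE gmulfM conjMg.
Qed.

HB.instance Definition _ :=
  isUMagmaMorphism.Build G H mono_lift_fun mono_lift_is_hom.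

Fact mono_lift_inj : injective mono_lift_fun.
Proof.
move=> x y xy; apply: (@mono_inj _ _ n); apply: (conjg_inj k).
by rewrite -!mono_lift_funE xy.
Qed.

Definition mono_lift := @Monomorphism G H mono_lift_fun mono_lift_inj.
End MonoLift.

(** * The action of paths on the fibres *)

Section Fibre.
Variables (B A : gog) (mu : gog_mor B A).

(** A representative [(v, g)] of a point of the fibre over [u]; the points
    themselves are the classes for [fp_eq].  The equation [mu v = u] is kept as
    a field because [u] is prescribed by a path of [A]. *)
Record fpoint (u : A) := FPoint {
  fp_vert : B;
  fp_over : mu fp_vert = u;
  fp_elt : vgrp u
}.

Definition fp_mul u (s : fpoint u) (a : vgrp u) : fpoint u :=
  FPoint (fp_over s) (fp_elt s * a).

Definition fp_eq u (s t : fpoint u) : Prop :=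
  exists b : vgrp (fp_vert s), t = FPoint (fp_over s)
    (ecast z (vgrp z) (fp_over s) (mvert mu _ b) * fp_elt s).

(** In the action of paths, [e] carries the class of [s] to that of [s'] by way
    of the edge [f] of [B].  The factors [b] and [b'] absorb the choice of
    representatives of the two cosets, and the common [x] ties their ends
    together. *)
Definition crosses u u' (e : edge u u') (s : fpoint u) (s' : fpoint u')
    (f : edge (fp_vert s) (fp_vert s')) : Prop :=
  ecast z (edge z u') (fp_over s)
    (ecast z (edge (mu (fp_vert s)) z) (fp_over s') (hedge mu f)) = e /\
  exists b b' (x : egrp (hedge mu f)),
    fp_elt s = ecast z (vgrp z) (fp_over s)
      (mvert mu _ b * tw_alpha mu f * alpha (hedge mu f) x) /\
    fp_elt s' = ecast z (vgrp z) (fp_over s')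
      (mvert mu _ b' * tw_omega mu f * omega (hedge mu f) x).

Definition step u u' (e : edge u u') (s : fpoint u) (s' : fpoint u') : Prop :=
  exists f, crosses e (s:=s) (s':=s') f.

Lemma crosses_step u u' (e : edge u u') s s' f :
  @crosses _ _ e s s' f -> step e s s'.
Proof. by exists f. Qed.

Lemma fp_eq_refl u (s : fpoint u) : fp_eq s s.
Proof.
case: s => v E g; subst u; by exists 1; rewrite /= gmulf1 mul1g.
Qed.

Lemma fp_eq_sym u (s t : fpoint u) : fp_eq s t -> fp_eq t s.
Proof.
case: s => v E g; subst u => -[b ->]; exists b^-1 => /=.
by rewrite gmulfV mulKg.
Qed.

Lemma fp_eq_trans u (s t r : fpoint u) : fp_eq s t -> fp_eq t r -> fp_eq s r.
Proof.
case: s => v E g; subst u => -[b ->] -[/= b' ->]; exists (b' * b) => /=.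
by rewrite gmulfM mulgA.
Qed.

Lemma fp_eq_mul u (s t : fpoint u) a : fp_eq s t -> fp_eq (fp_mul s a) (fp_mul t a).
Proof.
by case: s => v E g; subst u => -[b ->]; exists b; rewrite /fp_mul /= mulgA.
Qed.

Lemma fp_mul1 u (s : fpoint u) : fp_mul s 1 = s.
Proof. by case: s => v E g; rewrite /fp_mul /= mulg1. Qed.

Lemma fp_mulM u (s : fpoint u) a b : fp_mul s (a * b) = fp_mul (fp_mul s a) b.
Proof. by rewrite /fp_mul /= mulgA. Qed.

Lemma step_eq u u' (e : edge u u') s t s' t' :
  fp_eq s t -> fp_eq s' t' -> step e s s' -> step e t t'.
Proof.
case: s s' => v E g [v' E' g']; subst u u' => -[c ->] -[c' ->] [/= f].
case=> [/= <- [b [b' [x [-> ->]]]]]; exists f; split => //=.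
by exists (c * b), (c' * b'), x; rewrite !gmulfM !mulgA.
Qed.

(** This is the relation [alpha_e(x) e = e omega_e(x)] acting on the fibres. *)
Lemma step_mul u u' (e : edge u u') s s' (x : egrp e) :
  step e s s' -> step e (fp_mul s (alpha e x)) (fp_mul s' (omega e x)).
Proof.
case: s s' => v E g [v' E' g']; subst u u' => -[/= f [/= fe]]; subst e.
case=> [b [b' [y [-> ->]]]]; exists f; split => //=.
by exists b, b', (y * x); rewrite !gmulfM !mulgA.
Qed.

Lemma crosses_inv u u' (e : edge u u') s s' f :
  @crosses _ _ e s s' f -> @crosses _ _ (einv e) s' s (einv f).
Proof.
case: s s' f => v E g [v' E' g'] /= f; subst u u' => -[/= fe]; subst e.
case=> [b [b' [x [/= -> ->]]]]; split => /=; first exact: hedge_inv.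
have [x' xa xo] := egrp_invP x (hedge_inv mu f).
by exists b', b, x'; rewrite xa xo tw_inv_alpha tw_inv_omega.
Qed.

Lemma step_inv u u' (e : edge u u') s s' : step e s s' -> step (einv e) s' s.
Proof. by case=> f sf; exists (einv f); exact: crosses_inv. Qed.

Hypothesis mu_imm : immersion mu.

(** As [alpha_e] and [mu_v] are injective, an element of the intersection in the
    second immersion condition comes from one element of [B_f] on both sides. *)
Lemma immersion_edge v v' (f : @edge B v v') b x :
    mvert mu v b ^ tw_alpha mu f = alpha (hedge mu f) x ->
  exists2 y, x = medge mu f y & b = alpha f y.
Proof.
move=> bx; have := mu_imm.2 _ _ f => /seteqP[_ /(_ (alpha (hedge mu f) x))] [].
  by split; [exists (mvert mu v b) => //; exists b | exists x].
move=> _ [y _ <-] /mono_inj yx; exists y => //.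
apply: (@mono_inj _ _ (mvert mu v)); apply: (conjg_inj (tw_alpha mu f)).
by rewrite bx -yx -medge_alpha.
Qed.

(** The two hypotheses say that [f] and [f'] have the same image and the same
    double coset; the first immersion condition then identifies them together
    with their ends. *)
Lemma immersion_star v v' w (f : @edge B v v') (f' : edge v w) b x :
    existT (fun z => edge (mu v) z) (mu w) (hedge mu f') =
      existT _ (mu v') (hedge mu f) ->
    tw_alpha mu f' = mvert mu v b * tw_alpha mu f * alpha (hedge mu f) x ->
  existT (fun z => edge v z) w f' = existT _ v' f.
Proof.
move=> ff' twE; have ff: star_map mu (existT _ w f' : star v) =
  star_map mu (existT _ v' f : star v) by [].
apply/(mu_imm.1 _ _ _ ff).
rewrite /edge_dcoset /=.
have -> : range (alpha (hedge mu f')) = range (alpha (hedge mu f)).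
  move: (mu w) (hedge mu f') ff' => z e /esym E; have /= uz := projT1_eq E; subst z.
  by rewrite (existT_inj E).
rewrite twE; apply/seteqP; split=> z [h [c _ <-]] [k [y _ <-]] <-.
- exists (mvert mu v (c * b)); first by exists (c * b).
  exists (alpha (hedge mu f) (x * y)); first by exists (x * y).
  by rewrite !gmulfM !mulgA.
- exists (mvert mu v (c * b^-1)); first by exists (c * b^-1).
  exists (alpha (hedge mu f) (x^-1 * y)); first by exists (x^-1 * y).
  by rewrite !gmulfM !gmulfV !mulgA !mulgVK mulgK.
Qed.

(** Two factorizations of the same double coset representative use the same
    edge by the first immersion condition; their [x]-parts differ by an element
    of [mu_f(B_f)] by the second, and this difference is moved across the edge
    into the coset at its end. *)
Lemma crosses_func v v1 v2 u u' (e : edge u u') (E : mu v = u)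
    (E1 : mu v1 = u') (E2 : mu v2 = u') g g1 g2 b
    (s := FPoint E g) (t := FPoint E (ecast z (vgrp z) E (mvert mu v b) * g))
    (s' := FPoint E1 g1) (t' := FPoint E2 g2)
    (f1 : @edge B v v1) (f2 : @edge B v v2) :
  @crosses _ _ e s s' f1 -> @crosses _ _ e t t' f2 ->
  existT (fun z => edge v z) _ f2 = existT _ _ f1 /\ fp_eq s' t'.
Proof.
rewrite {}/s {}/t {}/s' {}/t'; subst u u' => -[/= <- [b1 [b1' [x1 [/= -> ->]]]]].
case=> /= f21 [b2 [b2' [x2 [gE ->]]]].
have ff : existT (fun z => edge (mu v) z) (mu v2) (hedge mu f2) =
    existT _ (mu v1) (hedge mu f1).
  by rewrite -f21; move: (mu v1) E2 {f21} => z E2; subst z.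
have [x xE] : exists x : egrp (hedge mu f1),
    tw_alpha mu f2 = mvert mu v (b2^-1 * (b * b1)) * tw_alpha mu f1 *
      alpha (hedge mu f1) x.
  (* f1 = f2 is not known yet: y is x2 as an element of the group of mu(f1). *)
  have [y yE] : exists y : egrp (hedge mu f1),
      alpha (hedge mu f1) y = alpha (hedge mu f2) x2.
    move: (mu v1) (hedge mu f1) ff => z k ff; have /= zE := projT1_eq ff.
    by subst z; rewrite -(existT_inj ff); exists x2.
  have -> : tw_alpha mu f2 = (mvert mu v b2)^-1 * (mvert mu v b * (mvert mu v b1 *
      tw_alpha mu f1 * alpha (hedge mu f1) x1)) * (alpha (hedge mu f1) y)^-1.
    by rewrite gE yE !mulgA mulgK mulVg mul1g.
  by exists (x1 * y^-1); rewrite !gmulfM !gmulfV !mulgA.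
have f12 := immersion_star ff xE.
split=> //; have /= v12 := projT1_eq f12; subst v2.
have {}f12 := existT_inj f12; subst f2.
rewrite (Prop_irrelevance E2 erefl) /= in gE *.
have [|y xyE _] := @immersion_edge v v1 f1 (b1^-1 * b^-1 * b2) (x1 * x2^-1).
  rewrite conjgE !gmulfM !gmulfV.
  have -> : mvert mu v b2 = mvert mu v b * (mvert mu v b1 * tw_alpha mu f1 *
      alpha (hedge mu f1) x1) * (alpha (hedge mu f1) x2)^-1 * (tw_alpha mu f1)^-1.
    by rewrite gE !mulgK.
  by rewrite !mulgA !mulgVK mulVg mul1g.
have -> : x2 = medge mu f1 y^-1 * x1 by rewrite gmulfV -xyE invgM invgK mulgVK.
exists (b2' * omega f1 y^-1 * b1'^-1) => /=; congr FPoint.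
rewrite !gmulfM medge_omega conjgE !gmulfV !mulgA !mulgVK.
by rewrite mulgK.
Qed.

Lemma crosses_uniq v v' u u' (e : edge u u') (E1 E2 : mu v = u)
    (E1' E2' : mu v' = u') g1 g2 g1' g2' f1 f2
    (s1 := FPoint E1 g1) (s2 := FPoint E2 g2) :
  fp_eq s1 s2 -> @crosses _ _ e s1 (FPoint E1' g1') f1 ->
  @crosses _ _ e s2 (FPoint E2' g2') f2 -> f1 = f2.
Proof.
rewrite {}/s1 {}/s2 (Prop_irrelevance E2 E1) => -[b /(congr1 (@fp_elt _)) /= ->].
move=> f1P f2P; apply/esym/existT_inj.
exact: (crosses_func f1P f2P).1.
Qed.

Lemma step_func u u' (e : edge u u') s s' t t' :
  fp_eq s t -> step e s s' -> step e t t' -> fp_eq s' t'.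
Proof.
case: s s' t' => v E g [v1 E1 g1] [v2 E2 g2] [b ->] [/= f1 f1P] [/= f2 f2P].
exact: (crosses_func f1P f2P).2.
Qed.

Fixpoint pstep u u' (p : gpath u u') : fpoint u -> fpoint u' -> Prop :=
  match p in gpath u u' return fpoint u -> fpoint u' -> Prop with
  | pnil _ a => fun s s' => fp_eq (fp_mul s a) s'
  | pcons _ _ _ a e q => fun s s' => exists2 t, step e (fp_mul s a) t & pstep q t s'
  end.

Lemma pstep_act u u' (p : gpath u u') a s s' :
  pstep (pact p a) s s' = pstep p (fp_mul s a) s'.
Proof. by case: p a s s' => * /=; rewrite fp_mulM. Qed.

Lemma pstep_eq u u' (p : gpath u u') s t s' t' :
  fp_eq s t -> fp_eq s' t' -> pstep p s s' -> pstep p t t'.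
Proof.
elim: p s t s' t' => [{}u a|{}u w {}u' a e q IH] s t s' t' st s't' /=.
  move=> ss'; apply: fp_eq_trans _ (fp_eq_trans ss' s't').
  exact/fp_eq_mul/fp_eq_sym.
case=> r sr rs'; exists r; last exact: IH (fp_eq_refl _) s't' rs'.
exact: step_eq (fp_eq_mul _ st) (fp_eq_refl _) sr.
Qed.

Lemma pstep_cat u u' u'' (p : gpath u u') (q : gpath u' u'') s s' :
  pstep (pcat p q) s s' <-> exists2 t, pstep p s t & pstep q t s'.
Proof.
elim: p q s s' => [{}u a|{}u w {}u' a e p IH] q s s' /=.
  rewrite pstep_act; split=> [ss'|[t st ts']].
    by exists (fp_mul s a) => //; exact: fp_eq_refl.
  exact: pstep_eq (fp_eq_sym st) (fp_eq_refl _) ts'.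
split=> [[r sr /IH[t rt ts']]|[t [r sr rt] ts']].
  by exists t => //; exists r.
by exists r => //; apply/IH; exists t.
Qed.

Lemma pstep_func u u' (p : gpath u u') s s' t t' :
  fp_eq s t -> pstep p s s' -> pstep p t t' -> fp_eq s' t'.
Proof.
elim: p s s' t t' => [{}u a|{}u w {}u' a e q IH] s s' t t' st /=.
  move=> ss' tt'; apply: fp_eq_trans _ tt'; apply: fp_eq_trans (fp_eq_sym ss') _.
  exact: fp_eq_mul.
case=> r sr rs' [r' tr' r't'].
exact: IH (step_func (fp_eq_mul _ st) sr tr') rs' r't'.
Qed.

(** The lift of [mu(q)] from the trivial coset is [q] itself: each twisting
    element of [mu(q)] is exactly what the crossing of its edge requires. *)
Lemma pstep_pmap v v' (q : @gpath B v v') :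
  pstep (pmap mu q) (FPoint erefl 1) (FPoint erefl 1).
Proof.
elim: q => [{}v b|{}v w {}v' b f q IH] /=.
  by exists b^-1; rewrite /= mul1g gmulfV mulVg.
exists (@FPoint (mu w) w erefl (tw_omega mu f)).
  exists f; split => //=; exists b, 1, 1.
  by rewrite !gmulf1 mul1g !mulg1 mul1g.
by rewrite pstep_act /fp_mul /= mulgV.
Qed.

End Fibre.

Section CoveringAction.
Variables (B A : gog) (mu : gog_mor B A).
Hypothesis mu_cov : covering mu.
Let mu_imm : immersion mu := mu_cov.1.

(** The double coset of [g] is one of those that the star of [v] must hit. *)
Lemma step_total u u' (e : edge u u') (s : fpoint mu u) :
  exists s', step e s s'.
Proof.
case: s => v E g; subst u.
have [_ _ surj] := mu_cov.2 v.
have [|[v' f] _ fP] := surj (existT _ u' e,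
    double_coset (range (mvert mu v)) g (range (alpha e))).
  by exists g.
have {surj} fe := congr1 fst fP; have /= uE := projT1_eq fe; subst u'.
have {}fe := existT_inj fe; rewrite /= in fe; subst e.
have [h [b _ <-] [k [x _ <-] gE]] : @edge_dcoset _ _ mu v (existT _ v' f : star v) g.
  have /= -> := congr1 snd fP; exists 1; first by exists 1 => //; rewrite gmulf1.
  by exists 1; [exists 1 => //; rewrite gmulf1 | rewrite mul1g mulg1].
exists (@FPoint _ _ mu (mu v') v' erefl (tw_omega mu f * omega (hedge mu f) x)), f.
by split=> //=; exists b, 1, x; rewrite gmulf1 mul1g.
Qed.

Lemma pstep_total u u' (p : gpath u u') (s : fpoint mu u) :
  exists s', pstep p s s'.
Proof.
elim: p s => [{}u a|{}u w {}u' a e q IH] s /=.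
  by exists (fp_mul s a); exact: fp_eq_refl.
by have [t st] := step_total e (fp_mul s a); have [s' ts'] := IH t; exists s', t.
Qed.

(** For the generating relation, the path [e omega_e(x) e^-1] goes across [e],
    slides [x] over and returns; by [step_mul] and uniqueness of steps it ends
    where [alpha_e(x)] does. *)
Lemma pstep_peq u u' (p q : gpath u u') : peq p q ->
  forall s s' : fpoint mu _, pstep p s s' <-> pstep q s s'.
Proof.
elim=> {u u' p q} [u v e x|//|u v p q _ IH|u v p q r _ IHp _ IHq|
  u v w p p' q q' _ IHp _ IHq] s s'.
- split=> /=; last first.
    move=> ss'; have [t st] := step_total e s.
    exists t; first by rewrite fp_mul1.
    exists (fp_mul s (alpha e x)); last by rewrite fp_mul1.
    exact: step_inv (step_mul x st).
  rewrite fp_mul1 => -[t st [r tr]]; rewrite fp_mul1; apply: fp_eq_trans.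
  exact (step_func mu_imm (fp_eq_refl _) (step_inv (step_mul x st)) tr).
- exact: iff_sym (IH s s').
- exact: iff_trans (IHp s s') (IHq s s').
- split=> /pstep_cat [t pt qt]; apply/pstep_cat; exists t.
  + exact/IHp.
  + exact/IHq.
  + exact/IHp.
  + exact/IHq.
Qed.

End CoveringAction.

(** * Construction of the lift *)

Lemma walk_gpath (A : gog) (u v : A) : walk u v -> inhabited (gpath u v).
Proof.
elim=> [{}u|{}u w {}v e _ [p]]; first exact: (inhabits (pnil 1)).
exact: (inhabits (pcons 1 e p)).
Qed.

Section LiftPoints.
Variables (C B A : gog) (mu : gog_mor B A) (nu : gog_mor C A).
Hypothesis mu_cov : covering mu.
Hypothesis C_conn : connected C.
Variables (w0 : C) (s0 : fpoint mu (nu w0)).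
Hypothesis s0_stab : forall p : gpath w0 w0, pstep (pmap nu p) s0 s0.

(** The clause at [w0] makes the family of points chosen from this lemma take
    the representative [s0] itself there, and not just its coset; the element of
    the equivalence at the basepoint has to be [1]. *)
Lemma lift_point_exists (w : C) : exists s : fpoint mu (nu w),
  (forall p : gpath w0 w, pstep (pmap nu p) s0 s) /\
  forall E : w0 = w, s = ecast z (fpoint mu (nu z)) E s0.
Proof.
have [E|ne] := pselect (w0 = w).
  by subst w; exists s0; split=> // E; rewrite (Prop_irrelevance E erefl).
have [q] := walk_gpath (C_conn w0 w).
have [s qs] := pstep_total mu_cov (pmap nu q) s0.
exists s; split=> // p.
(* p is q preceded by the circuit p q^-1, which fixes s0 *)
have pq : peq (pcat (pcat p (pinv q)) q) p.
  rewrite -pcatA -[X in peq _ X]pcatp1.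
  exact: peq_cat (peq_refl _) (pcatVp q).
apply/(pstep_peq mu_cov (pmap_peq nu pq)).
by rewrite pmap_cat; apply/pstep_cat; exists s0.
Qed.

(** A vertex group element of [C] at [w] and an edge of [C] from [w] both
    prolong a path from [w0] to [w], whence the two invariance properties. *)
Lemma lift_points : exists s : forall w, fpoint mu (nu w),
  [/\ s w0 = s0,
      forall w (c : vgrp w), fp_eq (s w) (fp_mul (s w) (mvert nu w c))
    & forall w w' (h : edge w w'),
        step (hedge nu h) (fp_mul (s w) (tw_alpha nu h))
          (fp_mul (s w') (tw_omega nu h))].
Proof.
pose s w := sval (cid (lift_point_exists w)).
have sP w := svalP (cid (lift_point_exists w)).
exists s.
have imm := mu_cov.1; split.
- exact: (sP w0).2 erefl.
- move=> w c; have [q] := walk_gpath (C_conn w0 w).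
  have qs := (sP w).1 q.
  have := (sP w).1 (pcat q (pnil c)); rewrite pmap_cat => /pstep_cat[t qt /= tc].
  apply: fp_eq_trans (fp_eq_sym tc) _; apply: fp_eq_mul.
  exact (pstep_func imm (fp_eq_refl _) qt qs).
- move=> w w' h; have [q] := walk_gpath (C_conn w0 w).
  have qs := (sP w).1 q.
  have := (sP w').1 (pcat q (pcons 1 h (pnil 1))).
  rewrite pmap_cat => /pstep_cat[t qt /= [r tr rs']].
  rewrite !gmulf1 mul1g mulg1 in tr rs'.
  have ts := pstep_func imm (fp_eq_refl _) qt qs.
  apply: step_eq tr; first exact: fp_eq_mul.
  by have := fp_eq_mul (tw_omega nu h) rs'; rewrite -fp_mulM mulVg fp_mul1.
Qed.
End LiftPoints.

Section BuildLift.
Variables (C B A : gog) (mu : gog_mor B A).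
Hypothesis mu_imm : immersion mu.
Variables (w0 : C).

(** The vertex map is conjugation by [g w] followed by [mu^-1].  Writing
    [g_u h_alpha = mu(b) f_alpha alpha(x)] for an edge [h] with image [f], the
    relation between the vertex map and the edge map of [n] shows that
    [alpha_e(x n_h(y) x^-1)] lies in the intersection of the second immersion
    condition for [f]; the corresponding element of [B_f] is the value of the
    edge map at [y]. *)
Lemma lift_over (phi : graph_hom C B) (n : gog_over (graph_comp mu phi))
    (g : forall w, vgrp (mu (phi w))) : g w0 = 1 ->
    (forall w c, exists b, mvert mu _ b = over_vert n w c ^ (g w)^-1) ->
    (forall u v (h : edge u v), @crosses _ _ mu _ _ (hedge mu (hedge phi h))
       (FPoint erefl (g u * over_tw_alpha n h))
       (FPoint erefl (g v * over_tw_omega n h)) (hedge phi h)) ->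
  exists m : gog_over phi, gog_sim w0 (gog_comp mu (GogMor m)) (GogMor n).
Proof.
move=> g0 gV gE.
pose R u v (h : edge u v) b b' := exists x : egrp (hedge mu (hedge phi h)),
  g u * over_tw_alpha n h =
    mvert mu _ b * tw_alpha mu (hedge phi h) * alpha (hedge mu (hedge phi h)) x /\
  g v * over_tw_omega n h =
    mvert mu _ b' * tw_omega mu (hedge phi h) * omega (hedge mu (hedge phi h)) x.
have [||ta [to [taV toV R_tw]]] := @edge_choice C (fun w => vgrp (phi w)) R.
- by move=> u v h; have [_ [b [b' [x [/= ? ?]]]]] := gE _ _ h; exists b, b', x.
- move=> u v h b b' [x [xa xo]].
  have e2 : hedge mu (hedge phi (einv h)) = einv (hedge mu (hedge phi h)).
    by rewrite !hedge_inv.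
  have [x' xa' xo'] := egrp_invP x e2.
  exists x'; rewrite xa' xo' over_tw_inv_alpha over_tw_inv_omega.
  by rewrite hedge_inv tw_inv_alpha tw_inv_omega.
pose tx u v h := sval (cid (R_tw u v h)).
have txa u v h : g u * over_tw_alpha n h = mvert mu _ (ta u v h) *
    tw_alpha mu (hedge phi h) * alpha (hedge mu (hedge phi h)) (tx u v h).
  by have [] := svalP (cid (R_tw u v h)).
have txo u v h : g v * over_tw_omega n h = mvert mu _ (to u v h) *
    tw_omega mu (hedge phi h) * omega (hedge mu (hedge phi h)) (tx u v h).
  by have [] := svalP (cid (R_tw u v h)).
pose mv w := mono_lift (gV w).
have mvE w c : mvert mu _ (mv w c) = over_vert n w c ^ (g w)^-1.
  exact: mono_lift_funE.
(* By txa, both sides are conjugates of the image of y in the group at u by the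
   element g_u^-1 mu(b) f_alpha = h_alpha alpha(x)^-1; keyo is the same at the
   other end. *)
have key u v (h : edge u v) (y : egrp h) :
    mvert mu _ (mv u (alpha h y) ^ ta u v h) ^ tw_alpha mu (hedge phi h) =
    alpha (hedge mu (hedge phi h)) (over_edge n h y ^ (tx u v h)^-1).
  have twE : mvert mu _ (ta u v h) * tw_alpha mu (hedge phi h) =
      g u * over_tw_alpha n h * (alpha (hedge mu (hedge phi h)) (tx u v h))^-1.
    by rewrite txa mulgK.
  rewrite monoJ mvE monoJ (over_alpha n) monoV -!conjgM.
  by rewrite twE -mulgA mulKg.
have keyo u v (h : edge u v) (y : egrp h) :
    mvert mu _ (mv v (omega h y) ^ to u v h) ^ tw_omega mu (hedge phi h) =
    omega (hedge mu (hedge phi h)) (over_edge n h y ^ (tx u v h)^-1).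
  have twE : mvert mu _ (to u v h) * tw_omega mu (hedge phi h) =
      g v * over_tw_omega n h * (omega (hedge mu (hedge phi h)) (tx u v h))^-1.
    by rewrite txo mulgK.
  rewrite monoJ mvE monoJ (over_omega n) monoV -!conjgM.
  by rewrite twE -mulgA mulKg.
have ez u v (h : edge u v) (y : egrp h) :
    exists z, medge mu (hedge phi h) z = over_edge n h y ^ (tx u v h)^-1.
  by have [z -> _] := immersion_edge mu_imm (key u v h y); exists z.
pose me u v h := mono_lift (ez u v h).
have meE u v h y : medge mu (hedge phi h) (me u v h y) =
    over_edge n h y ^ (tx u v h)^-1 by exact: mono_lift_funE.
have me_alpha u v h y :
    alpha (hedge phi h) (me u v h y) = mv u (alpha h y) ^ ta u v h.
  apply: (@mono_inj _ _ (mvert mu _)); apply: (conjg_inj (tw_alpha mu (hedge phi h))).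
  by rewrite key -meE medge_alpha.
have me_omega u v h y :
    omega (hedge phi h) (me u v h y) = mv v (omega h y) ^ to u v h.
  apply: (@mono_inj _ _ (mvert mu _)); apply: (conjg_inj (tw_omega mu (hedge phi h))).
  by rewrite keyo -meE medge_omega.
exists (GogOver taV toV me_alpha me_omega).
apply: GogSim.
exists g, tx; split=> //.
- move=> u v h; apply/same_elt_einv; first by rewrite /= !hedge_inv.
  apply: (@mulgI _ (mvert mu _ (to u v h) * tw_omega mu (hedge phi h))).
  rewrite -[RHS]txo -over_tw_inv_alpha [RHS]txa taV.
  by rewrite -[tw_omega _ _]tw_inv_alpha -hedge_inv.
- by move=> w c; rewrite [X in X ^ _](mvE w c) -conjgM mulVg conjg1.
- move=> u v h; rewrite -[LHS](mulgK (over_tw_alpha n h)).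
  by rewrite (txa u v h).
Qed.

(** The vertices of the given points determine the graph morphism: the edge
    crossed by [nu(h)] is unique, hence compatible with inversion.  Once the
    graph morphism of [nu] is replaced by its factorization through [mu], the
    groups are handled by [lift_over]. *)
Lemma lift_of_points (nu : gog_mor C A) (s : forall w, fpoint mu (nu w)) :
    fp_elt (s w0) = 1 ->
    (forall w c, fp_eq (s w) (fp_mul (s w) (mvert nu w c))) ->
    (forall u v (h : edge u v), step (hedge nu h)
       (fp_mul (s u) (tw_alpha nu h)) (fp_mul (s v) (tw_omega nu h))) ->
  exists2 sigma : gog_mor C B, sigma w0 = fp_vert (s w0)
    & gog_sim w0 (gog_comp mu sigma) nu.
Proof.
have [sv [g [E ->]]] : exists (sv : C -> B) (g : forall w, vgrp (nu w))
    (E : forall w, mu (sv w) = nu w), s = fun w => FPoint (E w) (g w).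
  exists (fun w => fp_vert (s w)), (fun w => fp_elt (s w)), (fun w => fp_over (s w)).
  by apply: functional_extensionality_dep => w; case: (s w).
case: nu {s} g E => -[hv he hp] n /= g E g0 gV gE.
have hvE : (fun w => mu (sv w)) = hv by apply: funext => w; rewrite -E.
subst hv; have EE : E = (fun=> erefl) by exact: Prop_irrelevance.
subst E.
have [f fP] : exists f : forall u v : C, edge u v -> edge (sv u) (sv v),
    forall u v h, @crosses _ _ mu _ _ (he u v h)
      (FPoint erefl (g u * over_tw_alpha n h))
      (FPoint erefl (g v * over_tw_omega n h)) (f u v h).
  exists (fun u v h => sval (cid (gE u v h))) => u v h.
  exact: (svalP (cid (gE u v h))).
have heE : (fun u v h => hedge mu (f u v h)) = he.
  apply: functional_extensionality_dep => u; apply: functional_extensionality_dep => v.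
  by apply: functional_extensionality_dep => h; have [] := fP u v h.
have fV u v (h : edge u v) : f v u (einv h) = einv (f u v h).
  have := crosses_inv (fP u v h); rewrite -hp.
  apply: (crosses_uniq mu_imm _ (fP v u (einv h))).
  rewrite over_tw_inv_alpha; exact: fp_eq_refl.
subst he; have hpE := Prop_irrelevance hp (graph_comp_inv mu (GraphHom fV)).
subst hp.
have [||m mP] := @lift_over (GraphHom fV) n g g0.
- move=> w c; have [b bE] := gV w c; exists b.
  have /= gE' := congr1 (@fp_elt _ _ _ _) bE.
  by rewrite conjgE invgK; apply: (mulIg (g w)); rewrite mulgA mulgVK; exact: esym gE'.
- exact: fP.
by exists (GogMor m).
Qed.

End BuildLift.

(** * Equivalent morphisms and fundamental groups *)

(** The condition on the [alpha]-twisting element of the inverse edge. *)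
Lemma over_sim_omega (B A : gog) (phi : graph_hom B A) (m1 m2 : gog_over phi)
    (a : forall v : B, vgrp (phi v))
    (b : forall (u v : B) (f : edge u v), egrp (hedge phi f)) :
    (forall (u v : B) (f : edge u v), same_elt (b v u (einv f)) (b u v f)) ->
    (forall (u v : B) (f : edge u v),
       a u = over_tw_alpha m1 f * alpha (hedge phi f) (b u v f) *
             (over_tw_alpha m2 f)^-1) ->
  forall (u v : B) (f : edge u v),
    a v = over_tw_omega m1 f * omega (hedge phi f) (b u v f) *
          (over_tw_omega m2 f)^-1.
Proof.
move=> bV aE u v f; rewrite (aE v u (einv f)) !over_tw_inv_alpha.
by congr (_ * _ * _); apply/same_elt_einv => //; exact: hedge_inv.
Qed.

Lemma peq_slide (A : gog) (u w v : A) (c : vgrp u) (e : edge u w) (x : egrp e)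
    (p : gpath w v) :
  peq (pcons (c * alpha e x) e p) (pcons c e (pact p (omega e x))).
Proof.
have slide : peq (pcat (pnil (alpha e x)) (pcons 1 e (pnil 1)))
    (pcons 1 e (pnil (omega e x))).
  apply: peq_trans (peq_cat (peq_sym (peq_edge x)) (peq_refl _)) _.
  have -> : pcat (pcons 1 e (pcons (omega e x) (einv e) (pnil 1)))
      (pcons 1 e (pnil 1)) = pcat (pcons 1 e (pnil (omega e x)))
      (pcons 1 (einv e) (pcons 1 e (pnil 1))) by rewrite /= !mulg1.
  rewrite -[X in peq _ X]pcatp1.
  exact: peq_cat (peq_refl _) (peq_edge1V e).
have := peq_cat (peq_cat (peq_refl (pnil c)) slide) (peq_refl p).
by rewrite /= !mulg1 pact1.
Qed.

(** On a path from [u] to [v] the images differ by [a u] and [a v] at the ends,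
    and the edge elements [b] slide across the edges; at the basepoint
    [a v0 = 1]. *)
Lemma over_sim_pmap (B A : gog) (v0 : B) (phi : graph_hom B A)
    (m1 m2 : gog_over phi) (p : gpath v0 v0) : over_sim v0 m1 m2 ->
  peq (pmap (GogMor m1) p) (pmap (GogMor m2) p).
Proof.
case=> a [b [a0 bV aV aE]]; have aO := over_sim_omega bV aE.
suff H u v (q : gpath u v) : peq (pcat (pmap (GogMor m1) q) (pnil (a v)))
    (pact (pmap (GogMor m2) q) (a u)).
  by have := H _ _ p; rewrite a0 pact1 pcatp1.
elim: q => [{}u c|{}u w {}v c f q IH] /=.
  by rewrite /mvert /= aV conjgE mulVKg; exact: peq_refl.
rewrite pcat_act.
apply: peq_trans (_ : peq _ (pcons (mvert (GogMor m1) u c *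
  tw_alpha (GogMor m1) f) (hedge phi f) (pact (pact (pmap (GogMor m2) q) (a w))
     (tw_omega (GogMor m1) f)^-1))) _.
  have cons_cat z (r : gpath _ z) y : pcons y (hedge phi f) (pact r
     (tw_omega (GogMor m1) f)^-1) =
     pcat (pcons y (hedge phi f) (pnil (tw_omega (GogMor m1) f)^-1)) r.
    by [].
  by rewrite !cons_cat; apply: peq_cat (peq_refl _) IH.
rewrite -pactM (aO _ _ f) /tw_alpha /tw_omega /= -!mulgA mulKg pactM.
apply: peq_trans (peq_sym (peq_slide _ _ _)) _.
rewrite /mvert /= aV conjgE !mulgA mulgV mul1g.
have -> : over_vert m1 u c * a u * over_tw_alpha m2 f =
    over_vert m1 u c * over_tw_alpha m1 f * alpha (hedge phi f) (b u w f).
  by rewrite (aE _ _ f) !mulgA mulgVK.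
exact: peq_refl.
Qed.

Lemma pmap_comp (C B A : gog) (nu : gog_mor B A) (mu : gog_mor C B)
    (u v : C) (p : gpath u v) :
  pmap (gog_comp nu mu) p = pmap nu (pmap mu p).
Proof.
elim: p => [//|{}u w {}v c f q IH] /=.
rewrite IH pmap_act -pactM /tw_alpha /tw_omega /=.
by rewrite /comp_tw_omega /comp_tw_alpha invgM monoV gmulfM mulgA.
Qed.

Lemma psim_pi1_star (B A : pgog) (M1 M2 : pgog_mor B A) :
  psim M1 M2 -> pi1_star M1 =1 pi1_star M2.
Proof.
case: M1 M2 => [N1 b1] [N2 b2]; rewrite /psim /pi1_star /= => N12 x.
case: N1 N2 / N12 b1 b2 => phi m1 m2 m12 b1 b2 /=.
rewrite (Prop_irrelevance b2 b1); congr (ecast u (pi1 u) _ _).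
by apply/pi1P; exact: over_sim_pmap.
Qed.

Lemma pi1_star_comp (C B A : pgog) (nu : pgog_mor B A) (mu : pgog_mor C B)
    (x : pi1 (base C)) :
  pi1_star (pgog_comp nu mu) x = pi1_star nu (pi1_star mu x).
Proof.
rewrite /pi1_star /=; move: (pgog_comp_base nu mu) (pmor_base nu) (pmor_base mu).
rewrite /=; move: (base B) => v0 E1 E2 E3; subst v0 => /=.
rewrite (Prop_irrelevance E1 E2); congr (ecast u (pi1 u) _ _).
by apply/pi1P; rewrite pmap_comp; apply/pmap_peq/peq_sym/pi1_repr.
Qed.

(** * Uniqueness of the lift *)

Section Uniqueness.
Variables (C B A : gog) (mu : gog_mor B A) (w0 : C).
Hypothesis mu_imm : immersion mu.
Hypothesis C_conn : connected C.

(** The elements [a v] lie in [mu(B_v)]: this holds at the basepoint and is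
    propagated along an edge [h], as [a u] in [mu(B_u)] forces the edge element
    [b] of [h] into [mu_f(B_f)] by the second immersion condition, and
    [a v] is expressed by [b].  Injectivity of [mu] then brings the equivalence
    down to [B]. *)
Lemma immersion_over_sim (phi : graph_hom C B) (m1 m2 : gog_over phi) :
  over_sim w0 (mor_over (gog_comp mu (GogMor m1)))
    (mor_over (gog_comp mu (GogMor m2))) -> over_sim w0 m1 m2.
Proof.
case=> a [b [a0 bV aV aE]]; have aO := over_sim_omega bV aE.
have step_d u v (h : edge u v) d : a u = mvert mu (phi u) d ->
    exists y, [/\ b u v h = medge mu (hedge phi h) y,
      d = over_tw_alpha m1 h * alpha (hedge phi h) y * (over_tw_alpha m2 h)^-1
      & a v = mvert mu (phi v) (over_tw_omega m1 h *
          omega (hedge phi h) y * (over_tw_omega m2 h)^-1)].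
  move=> ad; have [|y bE dE] := @immersion_edge _ _ mu mu_imm _ _ (hedge phi h)
      ((over_tw_alpha m1 h)^-1 * d * over_tw_alpha m2 h) (b u v h).
    have aE' : a u = mvert mu _ (over_tw_alpha m1 h) * tw_alpha mu (hedge phi h) *
        alpha (hedge mu (hedge phi h)) (b u v h) *
        (mvert mu _ (over_tw_alpha m2 h) * tw_alpha mu (hedge phi h))^-1 := aE u v h.
    by rewrite conjgE !gmulfM monoV -ad aE' invgM !mulgA !mulgVK mulVg mul1g.
  exists y; split=> //.
    by rewrite -dE !mulgA mulgV mul1g mulgK.
  have -> : a v = mvert mu _ (over_tw_omega m1 h) * tw_omega mu (hedge phi h) *
      omega (hedge mu (hedge phi h)) (b u v h) *
      (mvert mu _ (over_tw_omega m2 h) * tw_omega mu (hedge phi h))^-1 := aO u v h.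
  by rewrite bE medge_omega conjgE !gmulfM monoV invgM !mulgA !mulgK.
have dP v : exists d, a v = mvert mu (phi v) d.
  have : exists d, a w0 = mvert mu (phi w0) d by exists 1; rewrite gmulf1.
  elim: (C_conn w0 v) => [//|u w {}v h _ IH [d ad]]; apply: IH.
  by have [y [_ _ ->]] := step_d _ _ h d ad; eexists.
pose d v := sval (cid (dP v)).
have dE v : a v = mvert mu (phi v) (d v) := svalP (cid (dP v)).
pose y u v h := cid (step_d u v h _ (dE u)).
have {y} [y yP] : exists y : forall u v (h : edge u v), egrp (hedge phi h),
    forall u v h, [/\ b u v h = medge mu (hedge phi h) (y u v h),
      d u = over_tw_alpha m1 h * alpha (hedge phi h) (y u v h) *
        (over_tw_alpha m2 h)^-1
    & a v = mvert mu (phi v) (over_tw_omega m1 h *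
          omega (hedge phi h) (y u v h) * (over_tw_omega m2 h)^-1)].
  by exists (fun u v h => sval (y u v h)) => u v h; exact: (svalP (y u v h)).
exists d, y; split.
- by apply: (@mono_inj _ _ (mvert mu (phi w0))); rewrite -dE a0 gmulf1.
- move=> u v h; apply/same_elt_einv; first exact: hedge_inv.
  have [_ dE1 _] := yP v u (einv h); have [_ _ dE2] := yP u v h.
  rewrite !over_tw_inv_alpha in dE1; move: dE2.
  rewrite dE => /mono_inj; rewrite dE1 => /mulIg /mulgI ->; exact: erefl.
- move=> v x; apply: (@mono_inj _ _ (mvert mu (phi v))).
  by rewrite monoJ -dE; exact: aV.
- by move=> u v h; have [] := yP u v h.
Qed.

(** The equation [a_u h_alpha = (mu sigma)(h)_alpha alpha(b)] contained in an
    equivalence is a factorization as in [crosses]. *)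
Lemma gog_sim_crosses (sigma : gog_mor C B) (nu : gog_mor C A) :
  gog_sim w0 (gog_comp mu sigma) nu ->
  exists (E : forall w, mu (sigma w) = nu w) (a : forall w, vgrp (nu w)),
    a w0 = 1 /\ forall u v (h : edge u v),
      @crosses _ _ mu _ _ (hedge nu h) (FPoint (E u) (a u * tw_alpha nu h))
        (FPoint (E v) (a v * tw_omega nu h)) (hedge sigma h).
Proof.
pose P (M : gog_mor C A) := existT (@gog_over C A) (mor_graph M) (mor_over M).
move=> sn; have [M MP Mn] : exists2 M, P M = P (gog_comp mu sigma) &
    gog_sim w0 M nu by exists (gog_comp mu sigma).
case: M nu / Mn MP {sn} => psi m1 m2 [a [b [a0 bV aV aE]]] PM.
have /= psiE := projT1_eq PM; subst psi.
have := existT_inj PM; rewrite [mor_over _]/= => m1E; subst m1.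
have aO := over_sim_omega bV aE.
exists (fun=> erefl), a; split=> // u v h; split=> //=.
exists (tw_alpha sigma h), (tw_omega sigma h), (b u v h).
by rewrite /tw_alpha /tw_omega /= {1}(aE u v h) {1}(aO u v h) !mulgVK.
Qed.

(** Both lifts give families of fibre points that agree at [w0] and are moved
    alike by the edges of [C]. *)
Lemma lift_unique (sigma sigma' : gog_mor C B) (nu : gog_mor C A) :
  sigma w0 = sigma' w0 -> gog_sim w0 (gog_comp mu sigma) nu ->
  gog_sim w0 (gog_comp mu sigma') nu -> gog_sim w0 sigma sigma'.
Proof.
move=> ss0 sn s'n.
have [E [a [a0 aP]]] := gog_sim_crosses sn.
have [E' [a' [a0' aP']]] := gog_sim_crosses s'n.
have agree w : fp_eq (FPoint (E w) (a w)) (FPoint (E' w) (a' w)).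
  have : fp_eq (FPoint (E w0) (a w0)) (FPoint (E' w0) (a' w0)).
    rewrite a0 a0'; move: (E w0) (E' w0); rewrite ss0 => E1 E2.
    by rewrite (Prop_irrelevance E1 E2); exact: fp_eq_refl.
  elim: (C_conn w0 w) => [//|u v {}w h _ IH uP]; apply: IH.
  have := step_func mu_imm (fp_eq_mul (tw_alpha nu h) uP)
    (crosses_step (aP _ _ h)) (crosses_step (aP' _ _ h)).
  by move/(fp_eq_mul (tw_omega nu h)^-1); rewrite /fp_mul /= !mulgK.
have := gog_sim_trans sn (gog_sim_sym s'n).
clear sn s'n a0 a0'.
case: sigma sigma' ss0 E E' aP aP' agree => -[hv he hp] m [[hv' he' hp'] m'] /=.
move=> _ E E' aP aP' agree.
have hvE : hv = hv'.
  by apply: funext => w; have [b /(congr1 (@fp_vert _ _ _ _))] := agree w.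
subst hv'.
have heE : he = he'.
  apply: functional_extensionality_dep => u; apply: functional_extensionality_dep => v.
  apply: functional_extensionality_dep => h.
  exact: (crosses_uniq mu_imm (fp_eq_mul (tw_alpha nu h) (agree u))
    (aP _ _ h) (aP' _ _ h)).
subst he'; rewrite (Prop_irrelevance hp' hp) in m' *.
move=> /gog_simE /immersion_over_sim; exact: GogSim.
Qed.

End Uniqueness.

(** * Lifting through a covering *)

(** The vertices [u] and [u0] are the images of the basepoint of [C] and the
    basepoint of [A], equal only through the pointedness of the morphisms. *)
Lemma pstep_pi1 (B A : gog) (mu : gog_mor B A) (v0 : B) (u u0 : A)
    (E1 : mu v0 = u0) (E2 : u = u0) (E : mu v0 = u)
    (q : gpath v0 v0) (r : gpath u u) : covering mu ->
  ecast z (pi1 z) E1 (\pi_(pi1 (mu v0)) (pmap mu q)) =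
    ecast z (pi1 z) E2 (\pi_(pi1 u) r) ->
  pstep r (FPoint E 1) (FPoint E 1).
Proof.
move=> cov; case: u / E E2 r => E2 r; case: u0 / E1 E2 => E2.
rewrite (Prop_irrelevance E2 erefl) /= => /pi1P qr.
exact/(pstep_peq cov qr)/pstep_pmap.
Qed.

Lemma covering_lift (A B C : pgog) (muB : pgog_mor B A) (muC : pgog_mor C A) :
  covering muB -> range (pi1_star muC) `<=` range (pi1_star muB) ->
  exists sigma : pgog_mor C B, psim (pgog_comp muB sigma) muC.
Proof.
move=> cov sub.
have E0 : muB (base B) = muC (base C) by rewrite !pmor_base.
pose s0 := FPoint E0 1.
have stab (p : gpath (base C) (base C)) : pstep (pmap muC p) s0 s0.
  have [x _] := sub _ (ex_intro2 _ _ (\pi_(pi1 (base C)) p) I erefl).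
  by rewrite -[x]reprK /pi1_star !pi1_mapE; exact: pstep_pi1.
have [s [s00 sV sE]] := lift_points cov (@pgog_connected C) stab.
have s1 : fp_elt (s (base C)) = 1 by rewrite s00.
have [sigma sb sC] := lift_of_points cov.1 s1 sV sE.
have sb' : sigma (base C) = base B by rewrite sb s00.
by exists (PGogMor sb').
Qed.

Lemma covering_lift_unique (A B C : pgog) (muB : pgog_mor B A)
    (muC : pgog_mor C A) (sigma sigma' : pgog_mor C B) : covering muB ->
  psim (pgog_comp muB sigma) muC -> psim (pgog_comp muB sigma') muC ->
  psim sigma sigma'.
Proof.
move=> cov; apply: (lift_unique cov.1 (@pgog_connected C)).
by rewrite !pmor_base.
Qed.

Lemma lift_pi1 (A B C : pgog) (muB : pgog_mor B A) (muC : pgog_mor C A)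
    (sigma : pgog_mor C B) : psim (pgog_comp muB sigma) muC ->
  range (pi1_star muC) `<=` range (pi1_star muB).
Proof.
move=> s _ [x _ <-]; exists (pi1_star sigma x) => //.
by rewrite -(pi1_star_comp muB sigma) (psim_pi1_star s).
Qed.

(** A cone over [mu^B] and [mu^C] is determined by its leg to [C]; its leg to
    [B] equals the composite with [sigma], because both are lifts of the same
    morphism. *)
Lemma lift_pullback (A B C : pgog) (muB : pgog_mor B A) (muC : pgog_mor C A)
    (sigma : pgog_mor C B) : covering muB -> psim (pgog_comp muB sigma) muC ->
  @is_pullback GrGp A B C (arrow_class muB) (arrow_class muC)
    C (arrow_class sigma) (arrow_class (pgog_id C)).
Proof.
move=> cov sC.
have sCE : @compc GrGp _ _ _ (arrow_class muB) (arrow_class sigma) = arrow_class muC.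
  by rewrite /= arrow_compE; apply/arrowP.
split=> [|P sB sC' sBC]; first by rewrite sCE; exact/esym/(@compc1r GrGp).
exists sC'; split=> [|x [_ <-]]; last exact: (@compc1 GrGp).
split; last exact: (@compc1 GrGp).
move: sBC; rewrite -sCE -(@compcA GrGp).
rewrite -[sB]reprK -[compc _ sC']reprK.
rewrite /= !arrow_compE => /arrowP sBC; apply/esym/arrowP.
exact: covering_lift_unique cov sBC (gog_sim_refl _ _).
Qed.

Theorem theorem4p11 (A B C : pgog) (muB : pgog_mor B A) (muC : pgog_mor C A)
    (muB_covering : covering muB) :
  [/\ (exists sigma : pgog_mor C B, psim (pgog_comp muB sigma) muC) <->
        range (pi1_star muC) `<=` range (pi1_star muB),
      forall sigma sigma' : pgog_mor C B,
        psim (pgog_comp muB sigma) muC ->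
        psim (pgog_comp muB sigma') muC ->
        psim sigma sigma'
    & forall sigma : pgog_mor C B,
        psim (pgog_comp muB sigma) muC ->
        @is_pullback GrGp A B C (arrow_class muB) (arrow_class muC)
          C (arrow_class sigma) (arrow_class (pgog_id C))].
Proof.
split=> [|sigma sigma'|sigma].
- split=> [[sigma]|]; [exact: lift_pi1 | exact: covering_lift].
- exact: covering_lift_unique.
- exact: lift_pullback.
Qed.
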